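(* Suppose Assumptions A and C hold. If there is a sequence $(h_j)_{j\in\mathbb N}$ in $\mathbb R^N$ with $h_j\to 0$ such that for every semidefinite face $\mathcal F$ of $\Gamma$ and every $j\in\mathbb N$ $$0\notin \operatorname{Proj}_{\mathcal V(\mathcal F)}\{b(\gamma)+h_j:\gamma\in\mathcal F\},$$ then $\mathrm{Opt}=\mathrm{Opt}_{\mathrm{SDP}}$.
   Context: Fix integers $N\ge 1$, $m_I,m_E\ge 0$, $m:=m_I+m_E\ge 1$; $[a,b]=\{a,\dots,b\}$, $[n]=[1,n]$. For $i\in[0,m]$ let $q_i(x)=x^\top A_ix+2b_i^\top x+c_i$ with $A_i\in\mathbb S^N$, $b_i\in\mathbb R^N$, $c_i\in\mathbb R$. $\mathrm{Opt}:=\inf\{q_0(x): q_i(x)\le 0\ \forall i\in[m_I],\ q_i(x)=0\ \forall i\in[m_I+1,m]\}$. Let $Q_i=\begin{pmatrix}c_i& b_i^\top\\ b_i& A_i\end{pmatrix}$; $\mathrm{Opt}_{\mathrm{SDP}}:=\inf\{\langle Q_0,Y\rangle: Y=\begin{pmatrix}1&x^\top\\ x& X\end{pmatrix}\succeq 0,\ X\in\mathbb S^N,\ \langle Q_i,Y\rangle\le 0\ \forall i\in[m_I],\ \langle Q_i,Y\rangle=0\ \forall i\in[m_I+1,m]\}$. For $\gamma\in\mathbb R^m$: $A(\gamma)=A_0+\sum\gamma_iA_i$, $b(\gamma)=b_0+\sum\gamma_ib_i$; $\Gamma:=\{\gamma: A(\gamma)\succeq0,\ \gamma_i\ge0\ \forall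 i\in[m_I]\}$. Assumption A: the QCQP feasible set is nonempty and some $\gamma^*$ with $\gamma^*_i\ge0$ ($i\in[m_I]$) has $A(\gamma^* )\succ0$. Assumption C: $\Gamma$ is a polyhedron. A nonempty face $\mathcal F$ of $\Gamma$ is semidefinite if no $\gamma\in\mathcal F$ has $A(\gamma)\succ0$; $\mathcal V(\mathcal F):=\{v\in\mathbb R^N: A(\gamma)v=0\ \forall\gamma\in\mathcal F\}$; $\operatorname{Proj}_V$ is orthogonal projection onto subspace $V$. *)

(* Defs.v *)
(* Stdlib (classical reals R).  Vectors of R^n are functions nat -> R
   of which only the coordinates 0..n-1 are meaningful; n x n matrices are
   functions nat -> nat -> R (entries (r,s) with r,s < n meaningful). *)
From Stdlib Require Import Reals.
Open Scope R_scope.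

Fixpoint sumN (n : nat) (f : nat -> R) : R :=
  match n with O => 0 | S n' => sumN n' f + f n' end.

Definition dot (n : nat) (u v : nat -> R) : R := sumN n (fun k => u k * v k).
Definition vnorm (n : nat) (u : nat -> R) : R := sqrt (dot n u u).
Definition matvec (n : nat) (M : nat -> nat -> R) (v : nat -> R) : nat -> R :=
  fun r => sumN n (fun s => M r s * v s).
Definition quad (n : nat) (M : nat -> nat -> R) (v : nat -> R) : R :=
  dot n v (matvec n M v).
Definition frob (n : nat) (P Y : nat -> nat -> R) : R :=
  sumN n (fun r => sumN n (fun s => P r s * Y r s)).

Definition symmetric (n : nat) (M : nat -> nat -> R) : Prop :=
  forall r s, (r < n)%nat -> (s < n)%nat -> M r s = M s r.
Definition psd (n : nat) (M : nat -> nat -> R) : Prop :=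
  symmetric n M /\ forall v : nat -> R, 0 <= quad n M v.
Definition pd (n : nat) (M : nat -> nat -> R) : Prop :=
  symmetric n M /\
  forall v : nat -> R, (exists k, (k < n)%nat /\ v k <> 0) -> 0 < quad n M v.

Definition veq (n : nat) (u v : nat -> R) : Prop := forall k, (k < n)%nat -> u k = v k.
Definition vzero (n : nat) (u : nat -> R) : Prop := veq n u (fun _ => 0).

Section Data.
Variables (N : nat) (A : nat -> nat -> nat -> R) (b : nat -> nat -> R) (c : nat -> R).

Definition qf (i : nat) (x : nat -> R) : R := quad N (A i) x + 2 * dot N (b i) x + c i.

Definition qcqp_feasible (mI mE : nat) (x : nat -> R) : Prop :=
  (forall i, (1 <= i <= mI)%nat -> qf i x <= 0) /\
  (forall i, (mI + 1 <= i <= mI + mE)%nat -> qf i x = 0).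

(* Block matrices of size (N+1) x (N+1), indices 0..N:
   Q_i = [[c_i, b_i^T],[b_i, A_i]],  Y = [[1, x^T],[x, X]]. *)
Definition Qmat (i : nat) : nat -> nat -> R := fun r s =>
  match r, s with
  | O, O => c i
  | O, S s' => b i s'
  | S r', O => b i r'
  | S r', S s' => A i r' s'
  end.
Definition Ymat (x : nat -> R) (X : nat -> nat -> R) : nat -> nat -> R := fun r s =>
  match r, s with
  | O, O => 1
  | O, S s' => x s'
  | S r', O => x r'
  | S r', S s' => X r' s'
  end.

Definition sdp_feasible (mI mE : nat) (x : nat -> R) (X : nat -> nat -> R) : Prop :=
  symmetric N X /\ psd (S N) (Ymat x X) /\
  (forall i, (1 <= i <= mI)%nat -> frob (S N) (Qmat i) (Ymat x X) <= 0) /\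
  (forall i, (mI + 1 <= i <= mI + mE)%nat -> frob (S N) (Qmat i) (Ymat x X) = 0).

Definition Agam (m : nat) (g : nat -> R) : nat -> nat -> R :=
  fun r s => A 0%nat r s + sumN m (fun k => g (S k) * A (S k) r s).
Definition bgam (m : nat) (g : nat -> R) : nat -> R :=
  fun r => b 0%nat r + sumN m (fun k => g (S k) * b (S k) r).

(* R^m is represented by functions g with coordinates g 1, ..., g m
   (all other coordinates are 0). *)
Definition in_Rm (m : nat) (g : nat -> R) : Prop :=
  g 0%nat = 0 /\ forall k, (m < k)%nat -> g k = 0.

Definition Gamma (mI mE : nat) (g : nat -> R) : Prop :=
  in_Rm (mI + mE) g /\ psd N (Agam (mI + mE) g) /\
  (forall i, (1 <= i <= mI)%nat -> 0 <= g i).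

Definition Vspace (m : nat) (F : (nat -> R) -> Prop) (v : nat -> R) : Prop :=
  forall g, F g -> vzero N (matvec N (Agam m g) v).

End Data.

Definition comb (t : R) (u v : nat -> R) : nat -> R := fun k => t * u k + (1 - t) * v k.

Definition convex_set (C : (nat -> R) -> Prop) : Prop :=
  forall u v t, C u -> C v -> 0 <= t <= 1 -> C (comb t u v).

Definition face (C F : (nat -> R) -> Prop) : Prop :=
  (forall u, F u -> C u) /\ convex_set F /\
  (forall u v t, C u -> C v -> 0 < t < 1 -> F (comb t u v) -> F u /\ F v).

Definition polyhedron (m : nat) (C : (nat -> R) -> Prop) : Prop :=
  exists (K : nat) (a : nat -> nat -> R) (beta : nat -> R),
    forall g, C g <-> (in_Rm m g /\
       forall l, (l < K)%nat -> sumN m (fun k => a l (S k) * g (S k)) <= beta l).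

Definition is_proj (n : nat) (V : (nat -> R) -> Prop) (w p : nat -> R) : Prop :=
  V p /\ forall v, V v -> dot n (fun k => w k - p k) v = 0.

(* Equality of infima (as extended reals in [-oo, +oo]) of two subsets of R:
   they have exactly the same lower bounds. *)
Definition lower_bound (S : R -> Prop) (t : R) : Prop := forall y, S y -> t <= y.
Definition same_inf (S T : R -> Prop) : Prop :=
  forall t, lower_bound S t <-> lower_bound T t.

(* Main.v *)
Require Import Defs.
From Stdlib Require Import Reals Lra Lia Psatz List Classical IndefiniteDescription FunctionalExtensionality.
Open Scope R_scope.

(* Write L(gamma, x) = q_0(x) + sum_i gamma_i q_i(x).  By weak duality the value of an SDP-feasible
   (x0, X0) bounds sup_{gamma in Gamma} L(gamma, x0), and the definite multiplier of Assumption A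
   makes this supremum coercive in x, so it has a minimiser x with value t.  The multipliers
   with L(gamma, x) = t form a face F of Gamma.  If F contains a definite gamma, one can
   move gamma in every admissible coordinate direction, which forces x to be QCQP-feasible with
   q_0(x) = t.  If F is semidefinite, Gamma is the slice of a finitely generated cone and Farkas'
   lemma gives either a gamma in F with b(gamma) orthogonal to V(F), or a direction v in V(F)
   along which every active generator of the cone decreases, contradicting minimality of x.
   The projection hypothesis excludes the first alternative for the objective perturbed by h_j.
   Hence every perturbed relaxation is exact; coercivity bounds the perturbed minimisers
   uniformly, and h_j -> 0 transfers the inequality to the original problem. *)

(** * Finite sums and dot products *)

Lemma sumN_ext n f g : (forall k, (k < n)%nat -> f k = g k) -> sumN n f = sumN n g.
Proof.
  induction n as [|n IH]; intros H; simpl; [reflexivity|].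
  rewrite IH, H by auto with arith; reflexivity.
Qed.

Lemma sumN_plus n f g : sumN n (fun k => f k + g k) = sumN n f + sumN n g.
Proof. induction n as [|n IH]; simpl; [|rewrite IH]; ring. Qed.

Lemma sumN_scal n t f : sumN n (fun k => t * f k) = t * sumN n f.
Proof. induction n as [|n IH]; simpl; [|rewrite IH]; ring. Qed.

Lemma sumN_zero n f : (forall k, (k < n)%nat -> f k = 0) -> sumN n f = 0.
Proof.
  induction n as [|n IH]; intros H; simpl; [reflexivity|].
  rewrite IH, H by auto with arith; ring.
Qed.

Lemma sumN_head n f : sumN (S n) f = f O + sumN n (fun k => f (S k)).
Proof.
  induction n as [|n IH]; [simpl; ring|].
  change (sumN (S (S n)) f) with (sumN (S n) f + f (S n)).
  rewrite IH; simpl; ring.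
Qed.

Lemma sumN_le n f g : (forall k, (k < n)%nat -> f k <= g k) -> sumN n f <= sumN n g.
Proof.
  induction n as [|n IH]; intros H; simpl; [lra|].
  assert (f n <= g n) by auto with arith.
  assert (sumN n f <= sumN n g) by auto with arith. lra.
Qed.

Lemma sumN_nonneg n f : (forall k, (k < n)%nat -> 0 <= f k) -> 0 <= sumN n f.
Proof.
  intros H. rewrite <- (sumN_zero n (fun _ => 0)) by auto. now apply sumN_le.
Qed.

Lemma sumN_exchange n m f :
  sumN n (fun r => sumN m (fun s => f r s)) = sumN m (fun s => sumN n (fun r => f r s)).
Proof.
  induction n as [|n IH]; simpl; [symmetry; now apply sumN_zero|].
  rewrite IH, <- sumN_plus. reflexivity.
Qed.

Lemma sumN_single n f i :
  (i < n)%nat -> (forall k, (k < n)%nat -> k <> i -> f k = 0) -> sumN n f = f i.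
Proof.
  induction n as [|n IH]; intros Hi H; [lia|]; simpl.
  destruct (PeanoNat.Nat.eq_dec i n) as [->|Hn].
  - rewrite sumN_zero by (intros k Hk; apply H; lia). ring.
  - rewrite IH, (H n) by (try lia; intros; apply H; lia). ring.
Qed.

Lemma sumN_term_le n f i :
  (forall k, (k < n)%nat -> 0 <= f k) -> (i < n)%nat -> f i <= sumN n f.
Proof.
  induction n as [|n IH]; intros H Hi; [lia|]; simpl.
  destruct (PeanoNat.Nat.eq_dec i n) as [->|Hn].
  - assert (0 <= sumN n f) by (apply sumN_nonneg; auto with arith). lra.
  - assert (f i <= sumN n f) by (apply IH; auto with arith; lia).
    assert (0 <= f n) by auto with arith. lra.
Qed.

Lemma dot_ext n u u' v v' : veq n u u' -> veq n v v' -> dot n u v = dot n u' v'.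
Proof. intros H H'. apply sumN_ext; intros k Hk. now rewrite H, H'. Qed.

Lemma dot_sym n u v : dot n u v = dot n v u.
Proof. apply sumN_ext; intros; ring. Qed.

Lemma dot_lin_l n t u s v w :
  dot n (fun k => t * u k + s * v k) w = t * dot n u w + s * dot n v w.
Proof.
  unfold dot. rewrite <- !sumN_scal, <- sumN_plus. apply sumN_ext; intros; ring.
Qed.

Lemma dot_lin_r n t u s v w :
  dot n w (fun k => t * u k + s * v k) = t * dot n w u + s * dot n w v.
Proof. rewrite dot_sym, dot_lin_l, !(dot_sym n w). reflexivity. Qed.

Lemma dot_plus_l n u v w : dot n (fun k => u k + v k) w = dot n u w + dot n v w.
Proof.
  rewrite (dot_ext n _ (fun k => 1 * u k + 1 * v k) w w), dot_lin_l;
    [ring|intros k _; ring|now intros k _].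
Qed.

Lemma dot_zero_l n u v : vzero n u -> dot n u v = 0.
Proof. intros H. apply sumN_zero; intros k Hk. rewrite H by easy. ring. Qed.

Lemma dot_self_nonneg n u : 0 <= dot n u u.
Proof. apply sumN_nonneg; intros; nra. Qed.

Lemma dot_self_coord n u k : (k < n)%nat -> u k * u k <= dot n u u.
Proof. intros Hk. apply (sumN_term_le n (fun k => u k * u k)); auto; intros; nra. Qed.

Lemma dot_self_eq0 n u : dot n u u = 0 -> vzero n u.
Proof. intros H k Hk. pose proof (dot_self_coord n u k Hk). nra. Qed.

(** Expand the square norm of t u - v, which is nonnegative, and divide by t. *)
Lemma dot_young n t u v : 0 < t -> 2 * dot n u v <= t * dot n u u + / t * dot n v v.
Proof.
  intros Ht.
  pose proof (dot_self_nonneg n (fun k => t * u k + (-1) * v k)) as H.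
  rewrite dot_lin_l, !dot_lin_r, (dot_sym n v u) in H.
  apply Rmult_le_reg_l with t; [easy|].
  replace (t * (t * dot n u u + / t * dot n v v)) with (t * t * dot n u u + dot n v v)
    by (field; lra).
  lra.
Qed.

Lemma dot_head n u v : dot (S n) u v = u O * v O + dot n (fun k => u (S k)) (fun k => v (S k)).
Proof. apply (sumN_head n (fun k => u k * v k)). Qed.

(** * Finitely generated cones *)

(** Conic combinations are built one generator at a time, so properties linear in y follow by
    induction without indexed coefficients. Both constructors work up to [veq], as coordinates from
    n on carry no meaning. *)
Inductive cone (n : nat) (P : (nat -> R) -> Prop) : (nat -> R) -> Prop :=
| cone_zero y : vzero n y -> cone n P y
| cone_add d l z y : P d -> 0 <= l -> cone n P z ->
    veq n y (fun k => l * d k + z k) -> cone n P y.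

Lemma cone_veq n P y z : veq n y z -> cone n P z -> cone n P y.
Proof.
  intros Hyz Hz. destruct Hz as [z Hz|d l w z Hd Hl Hw Hz].
  - apply cone_zero. intros k Hk. now rewrite Hyz, Hz.
  - apply (cone_add n P d l w); auto. intros k Hk. now rewrite Hyz, Hz.
Qed.

Lemma cone_gen n (P : (nat -> R) -> Prop) d : P d -> cone n P d.
Proof.
  intros Hd. apply (cone_add n P d 1 (fun _ => 0)); auto; [lra| |].
  - apply cone_zero. now intros k _.
  - intros k _; ring.
Qed.

Lemma cone_plus n P y z : cone n P y -> cone n P z -> cone n P (fun k => y k + z k).
Proof.
  intros Hy Hz. induction Hy as [y Hy|d l w y Hd Hl Hw IH Hy].
  - apply cone_veq with z; auto. intros k Hk. rewrite (Hy k Hk). ring.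
  - apply (cone_add n P d l (fun k => w k + z k)); auto.
    intros k Hk. rewrite (Hy k Hk). ring.
Qed.

Lemma cone_scal n P t y : 0 <= t -> cone n P y -> cone n P (fun k => t * y k).
Proof.
  intros Ht Hy. induction Hy as [y Hy|d l w y Hd Hl Hw IH Hy].
  - apply cone_zero. intros k Hk. rewrite (Hy k Hk). ring.
  - apply (cone_add n P d (t * l) (fun k => t * w k)); auto; [nra|].
    intros k Hk. rewrite (Hy k Hk). ring.
Qed.

Lemma cone_lin n P t y s z : 0 <= t -> 0 <= s -> cone n P y -> cone n P z ->
  cone n P (fun k => t * y k + s * z k).
Proof.
  intros Ht Hs Hy Hz.
  apply (cone_plus n P (fun k => t * y k) (fun k => s * z k)); now apply cone_scal.
Qed.

Lemma cone_sub n (P Q : (nat -> R) -> Prop) y :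
  (forall d, P d -> cone n Q d) -> cone n P y -> cone n Q y.
Proof.
  intros H Hy. induction Hy as [y Hy|d l z y Hd Hl Hz IH Hy].
  - now apply cone_zero.
  - apply cone_veq with (fun k => l * d k + 1 * z k).
    + intros k Hk. rewrite (Hy k Hk). ring.
    + apply cone_lin; auto; lra.
Qed.

Lemma cone_dot_nonpos n (P : (nat -> R) -> Prop) a y :
  (forall d, P d -> dot n a d <= 0) -> cone n P y -> dot n a y <= 0.
Proof.
  intros H Hy. induction Hy as [y Hy|d l z y Hd Hl Hz IH Hy].
  - rewrite dot_sym, dot_zero_l by easy. lra.
  - rewrite (dot_ext n a a y (fun k => l * d k + 1 * z k)).
    + rewrite dot_lin_r. specialize (H d Hd). nra.
    + now intros k _.
    + intros k Hk. rewrite (Hy k Hk). ring.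
Qed.

(* One step of the double description method: each generator violating the new inequality is
   combined with those satisfying it. *)
Section AddInequality.
Variables (n : nat) (a : nat -> R) (D : list (nat -> R)).

Let pos d := In d D /\ 0 < dot n a d.
Let nonpos d := In d D /\ dot n a d <= 0.
Let pairing (p q : nat -> R) : nat -> R := fun k => dot n a p * q k + - dot n a q * p k.
Let D' := filter (fun d => if Rle_dec (dot n a d) 0 then true else false) D ++
  flat_map (fun p => if Rlt_dec 0 (dot n a p) then
     map (pairing p) (filter (fun d => if Rle_dec (dot n a d) 0 then true else false) D)
     else nil) D.

Lemma in_refined_gens d :
  In d D' <-> nonpos d \/ exists p q, pos p /\ nonpos q /\ d = pairing p q.
Proof.
  assert (Hf : forall q, In q (filter (fun d => if Rle_dec (dot n a d) 0 then true else false) D)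
                         <-> nonpos q).
  { intros q. rewrite filter_In. unfold nonpos.
    destruct (Rle_dec (dot n a q) 0); intuition discriminate. }
  unfold D'. rewrite in_app_iff, Hf, in_flat_map. apply or_iff_compat_l. split.
  - intros [p [Hp H]]. destruct (Rlt_dec 0 (dot n a p)) as [Hp'|]; [|easy].
    apply in_map_iff in H. destruct H as [q [<- Hq]].
    exists p, q. split; [now split|]. split; [now apply Hf|easy].
  - intros [p [q [[Hp Hp'] [Hq ->]]]]. exists p. split; auto.
    destruct (Rlt_dec 0 (dot n a p)); [|easy]. now apply in_map, Hf.
Qed.

(** [pairing] is bilinear, so a double induction expands it into nonnegative combinations of
    pairings of generators, which belong to [D']. *)
Lemma cone_pairing z w : cone n pos z -> cone n nonpos w ->
  cone n (fun d => In d D') (pairing z w).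
Proof.
  intros Hz Hw. induction Hz as [z Hz|d l z' z Hd Hl Hz' IH Hz].
  - apply cone_zero. intros k Hk. unfold pairing.
    rewrite (dot_sym n a z), (dot_zero_l n z), (Hz k Hk) by easy. ring.
  - apply cone_veq with (fun k => l * pairing d w k + 1 * pairing z' w k).
    { intros k Hk. unfold pairing.
      rewrite (dot_ext n a a z (fun k => l * d k + 1 * z' k)), dot_lin_r, (Hz k Hk).
      - ring.
      - now intros j _.
      - intros j Hj. rewrite (Hz j Hj). ring. }
    apply cone_lin; auto; [lra|]. clear - Hd Hw.
    induction Hw as [w Hw|q l w' w Hq Hl Hw' IH Hw].
    + apply cone_zero. intros k Hk. unfold pairing.
      rewrite (dot_sym n a w), (dot_zero_l n w), (Hw k Hk) by easy. ring.
    + apply cone_veq with (fun k => l * pairing d q k + 1 * pairing d w' k).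
      { intros k Hk. unfold pairing.
        rewrite (dot_ext n a a w (fun k => l * q k + 1 * w' k)), dot_lin_r, (Hw k Hk).
        - ring.
        - now intros j _.
        - intros j Hj. rewrite (Hw j Hj). ring. }
      apply cone_lin; auto; [lra|]. apply cone_gen. apply in_refined_gens.
      right. now exists d, q.
Qed.

(** Sort the terms of y by the sign of a on their generators. The final disjunction ensures that a
    is nonzero on z unless z itself vanishes, so that one may divide later. *)
Lemma cone_split y : cone n (fun d => In d D) y ->
  exists z w, cone n pos z /\ cone n nonpos w /\ veq n y (fun k => z k + w k) /\
    (vzero n z \/ 0 < dot n a z).
Proof.
  intros Hy. induction Hy as [y Hy|d l y' y Hd Hl Hy' IH Hy].
  - exists (fun _ => 0), (fun _ => 0).
    repeat split; try (apply cone_zero; now intros k _).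
    + intros k Hk. rewrite (Hy k Hk). ring.
    + left. now intros k _.
  - destruct IH as [z [w [Hz [Hw [He Hc]]]]].
    destruct (Rle_dec (dot n a d) 0) as [Hneg|Hpos].
    + exists z, (fun k => l * d k + w k). repeat split; auto.
      * apply (cone_add n nonpos d l w); unfold nonpos; auto. now intros k _.
      * intros k Hk. rewrite (Hy k Hk), (He k Hk). ring.
    + exists (fun k => l * d k + 1 * z k), w. repeat split; auto.
      * apply cone_lin; auto; try lra. apply cone_gen. split; auto; lra.
      * intros k Hk. rewrite (Hy k Hk), (He k Hk). ring.
      * destruct (Req_dec l 0) as [->|Hl0].
        -- destruct Hc as [Hc|Hc].
           ++ left. intros k Hk. rewrite (Hc k Hk). ring.
           ++ right. rewrite dot_lin_r. lra.
        -- right. rewrite dot_lin_r.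
           assert (0 <= dot n a z).
           { destruct Hc as [Hc|Hc]; [|lra]. rewrite dot_sym, dot_zero_l by easy; lra. }
           assert (0 < l) by lra. assert (0 < dot n a d) by lra. nra.
Qed.

Lemma cone_add_inequality : exists E : list (nat -> R), forall y,
  cone n (fun d => In d E) y <-> cone n (fun d => In d D) y /\ dot n a y <= 0.
Proof.
  exists D'. intros y. split.
  - intros Hy. split.
    + revert Hy. apply cone_sub. intros d Hd. apply in_refined_gens in Hd.
      destruct Hd as [[Hd _]|[p [q [[Hp Hp'] [[Hq Hq'] ->]]]]].
      * now apply cone_gen.
      * apply cone_lin; try lra; now apply cone_gen.
    + revert Hy. apply cone_dot_nonpos. intros d Hd. apply in_refined_gens in Hd.
      destruct Hd as [[_ Hd]|[p [q [[Hp Hp'] [[Hq Hq'] ->]]]]]; [easy|].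
      unfold pairing. rewrite dot_lin_r. lra.
  - intros [Hy Ha]. destruct (cone_split y Hy) as [z [w [Hz [Hw [He Hc]]]]].
    assert (Hw' : cone n (fun d => In d D') w).
    { revert Hw. apply cone_sub. intros d Hd. apply cone_gen, in_refined_gens. now left. }
    destruct Hc as [Hc|Hc].
    + apply cone_veq with w; auto. intros k Hk. rewrite (He k Hk), (Hc k Hk). ring.
    + assert (dot n a y = dot n a z + dot n a w) as Hs.
      { rewrite (dot_ext n a a y (fun k => 1 * z k + 1 * w k)).
        - rewrite dot_lin_r. ring.
        - now intros k _.
        - intros k Hk. rewrite (He k Hk). ring. }
      pose proof (cone_pairing z w Hz Hw) as Hu.
      assert (Hi : 0 < / - dot n a w) by (apply Rinv_0_lt_compat; lra).
      (* Here - a.w >= a.z > 0. Dividing the pairing by - a.w gives z plus a multiple of w with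
         factor at most 1; the rest of w keeps a nonnegative coefficient because a.y <= 0. *)
      apply cone_veq with
        (fun k => / - dot n a w * pairing z w k + (1 - dot n a z * / - dot n a w) * w k).
      * intros k Hk. rewrite (He k Hk). unfold pairing. field. lra.
      * apply cone_lin; auto; [lra|].
        assert (dot n a z * / - dot n a w <= - dot n a w * / - dot n a w)
          by (apply Rmult_le_compat_r; lra).
        rewrite Rinv_r in H by lra. lra.
Qed.

End AddInequality.

(** The vectors e_i and - e_i generate the space: the start of the double description, with no
    inequality imposed yet. *)
Lemma full_space_cone n : exists D : list (nat -> R), forall y, cone n (fun d => In d D) y.
Proof.
  pose (e i k := if Nat.eqb k i then 1 else 0).
  exists (flat_map (fun i => e i :: (fun k => - e i k) :: nil) (seq 0 n)). intros y.
  set (P := fun d => _).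
  assert (H : forall m, (m <= n)%nat -> cone n P (fun k => if Nat.ltb k m then y k else 0)).
  { induction m as [|m IH]; intros Hm.
    - apply cone_zero. now intros k _.
    - assert (Hl : forall c : R, exists d, P d /\ forall k, c * e m k = Rabs c * d k).
      { intros c.
        destruct (Rle_dec 0 c) as [Hc|Hc].
        - exists (e m). split.
          + apply in_flat_map. exists m. split; [apply in_seq; lia|now left].
          + intros k. now rewrite Rabs_pos_eq.
        - exists (fun k => - e m k). split.
          + apply in_flat_map. exists m. split; [apply in_seq; lia|now right; left].
          + intros k. rewrite Rabs_left by lra. ring. }
      destruct (Hl (y m)) as [d [Hd Hd']].
      apply (cone_add n P d (Rabs (y m)) (fun k => if Nat.ltb k m then y k else 0));
        auto with arith; [apply Rabs_pos|].
      intros k Hk. rewrite <- Hd'. unfold e.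
      destruct (PeanoNat.Nat.ltb_spec k (S m)), (PeanoNat.Nat.ltb_spec k m),
        (PeanoNat.Nat.eqb_spec k m); subst; try lia; ring. }
  apply cone_veq with (fun k => if Nat.ltb k n then y k else 0); auto.
  intros k Hk. apply PeanoNat.Nat.ltb_lt in Hk. now rewrite Hk.
Qed.

(** The Minkowski-Weyl direction from inequalities to generators, imposing one inequality at a
    time. *)
Lemma finite_inequalities_cone n (a : nat -> nat -> R) K :
  exists D : list (nat -> R), forall y,
    cone n (fun d => In d D) y <-> forall l, (l < K)%nat -> dot n (a l) y <= 0.
Proof.
  induction K as [|K [D HD]].
  - destruct (full_space_cone n) as [D HD]. exists D. intros y. split; auto. intros _ l Hl; lia.
  - destruct (cone_add_inequality n (a K) D) as [E HE]. exists E. intros y.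
    rewrite HE, HD. split.
    + intros [H H'] l Hl. destruct (PeanoNat.Nat.eq_dec l K) as [->|]; auto. apply H; lia.
    + intros H; split; auto with arith.
Qed.

(** Induction on the number of generators, with w and the list general because the recursion also
    runs on projected data. The difficult case is a vector v that separates w from the tail but is
    positive on the head d. *)
Lemma farkas n (D : list (nat -> R)) : forall w,
  cone n (fun d => In d D) w \/
  exists v, (forall d, In d D -> dot n d v <= 0) /\ 0 < dot n w v.
Proof.
  remember (length D) as len eqn:Hlen. revert D Hlen.
  induction len as [|len IH]; intros [|d D] Hlen w; try easy.
  - destruct (Req_dec (dot n w w) 0) as [H|H].
    + left. now apply cone_zero, dot_self_eq0.
    + right. exists w. split; [easy|]. pose proof (dot_self_nonneg n w). lra.
  - simpl in Hlen. injection Hlen as Hlen.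
    destruct (IH D Hlen w) as [Hw|[v [Hv Hwv]]].
    { left. revert Hw. apply cone_sub. intros x Hx. apply cone_gen. now right. }
    destruct (Rle_dec (dot n d v) 0) as [Hd|Hd].
    { right. exists v. split; auto. intros x [<-|Hx]; auto. }
    (* Project along d onto the hyperplane orthogonal to v. *)
    pose (pr x k := 1 * x k + - (dot n x v / dot n d v) * d k).
    assert (Hi : 0 < / dot n d v) by (apply Rinv_0_lt_compat; lra).
    destruct (IH (map pr D)) with (w := pr w) as [Hw|[u [Hu Hwu]]].
    { now rewrite length_map. }
    + left.
      (* Undoing the projection adds multiples of d: w.v > 0 and x.v <= 0 on the tail give these
         multiples the right sign. *)
      apply cone_veq with (fun k => 1 * pr w k + (dot n w v / dot n d v) * d k).
      { intros k Hk. unfold pr. ring. }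
      apply cone_lin; [lra|unfold Rdiv; nra| |apply cone_gen; now left].
      revert Hw. apply cone_sub. intros x Hx. apply in_map_iff in Hx.
      destruct Hx as [x' [<- Hx]]. specialize (Hv x' Hx). unfold pr.
      apply cone_lin; [lra|unfold Rdiv; nra| |]; apply cone_gen; [now right|now left].
    (* Correcting u by a multiple of v makes it orthogonal to d, and its product with any x is that
       of [pr x] with u. *)
    + right. exists (fun k => 1 * u k + - (dot n d u / dot n d v) * v k).
      assert (E : forall x, dot n x (fun k => 1 * u k + - (dot n d u / dot n d v) * v k)
                            = dot n (pr x) u).
      { intros x. unfold pr. rewrite dot_lin_l, dot_lin_r. field. lra. }
      split; [|now rewrite E].
      intros x [<-|Hx].
      * rewrite dot_lin_r. right. field. lra.
      * rewrite E. apply Hu. now apply in_map.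
Qed.

(** * Quadratic forms *)

Definition outer (u v : nat -> R) : nat -> nat -> R := fun r s => u r * v s.

Lemma frob_ext n P P' Y Y' :
  (forall r s, (r < n)%nat -> (s < n)%nat -> P r s = P' r s) ->
  (forall r s, (r < n)%nat -> (s < n)%nat -> Y r s = Y' r s) ->
  frob n P Y = frob n P' Y'.
Proof.
  intros H H'. apply sumN_ext; intros r Hr. apply sumN_ext; intros s Hs.
  now rewrite H, H'.
Qed.

Lemma frob_lin_l n t P s Q Y :
  frob n (fun i j => t * P i j + s * Q i j) Y = t * frob n P Y + s * frob n Q Y.
Proof.
  unfold frob. rewrite <- !sumN_scal, <- sumN_plus. apply sumN_ext; intros i _.
  rewrite <- !sumN_scal, <- sumN_plus. apply sumN_ext; intros j _. ring.
Qed.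

Lemma frob_sym n P Y : frob n P Y = frob n Y P.
Proof. apply sumN_ext; intros i _. apply sumN_ext; intros j _. ring. Qed.

Lemma frob_lin_r n t P s Q Y :
  frob n Y (fun i j => t * P i j + s * Q i j) = t * frob n Y P + s * frob n Y Q.
Proof. rewrite frob_sym, frob_lin_l, !(frob_sym n Y). reflexivity. Qed.

Lemma frob_sumN_l n m P Y :
  frob n (fun i j => sumN m (fun k => P k i j)) Y = sumN m (fun k => frob n (P k) Y).
Proof.
  induction m as [|m IH]; simpl.
  - apply sumN_zero; intros r _. apply sumN_zero; intros s _. ring.
  - rewrite <- IH.
    rewrite (frob_ext n _ (fun i j => 1 * sumN m (fun k => P k i j) + 1 * P m i j) Y Y), frob_lin_l;
      [ring|intros; ring|auto].
Qed.

Lemma dot_matvec n M u v : dot n u (matvec n M v) = frob n M (outer u v).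
Proof.
  unfold dot, matvec, frob, outer. apply sumN_ext; intros r _.
  rewrite <- sumN_scal. apply sumN_ext; intros s _. ring.
Qed.

Lemma quad_frob n M v : quad n M v = frob n M (outer v v).
Proof. apply dot_matvec. Qed.

Lemma frob_outer_outer n x v : frob n (outer x x) (outer v v) = dot n x v * dot n x v.
Proof.
  unfold dot at 1, frob, outer. rewrite Rmult_comm, <- sumN_scal.
  apply sumN_ext; intros r _. unfold dot. rewrite Rmult_comm, <- sumN_scal.
  apply sumN_ext; intros s _. ring.
Qed.

Lemma dot_matvec_sym n M u v : symmetric n M ->
  dot n u (matvec n M v) = dot n v (matvec n M u).
Proof.
  intros HM. rewrite !dot_matvec. unfold frob, outer. rewrite sumN_exchange.
  apply sumN_ext; intros r Hr. apply sumN_ext; intros s Hs.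
  rewrite (HM s r) by easy. ring.
Qed.

Lemma quad_line n M x t v : symmetric n M ->
  quad n M (fun k => x k + t * v k)
  = quad n M x + 2 * t * dot n x (matvec n M v) + t * t * quad n M v.
Proof.
  intros HM.
  rewrite (quad_frob n M (fun k => _)).
  rewrite (frob_ext n M M _ (fun r s => 1 * outer x x r s +
     1 * (t * (fun r s => 1 * outer x v r s + 1 * outer v x r s) r s + (t * t) * outer v v r s))).
  - rewrite !frob_lin_r, <- !dot_matvec, (dot_matvec_sym n M v x HM). unfold quad. ring.
  - auto.
  - intros r s _ _. unfold outer. ring.
Qed.

Lemma frob_S n P Y :
  frob (S n) P Y = frob n P Y + sumN n (fun r => P r n * Y r n)
    + sumN n (fun s => P n s * Y n s) + P n n * Y n n.
Proof. unfold frob; simpl. rewrite sumN_plus. ring. Qed.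

Lemma frob_head n P Y :
  frob (S n) P Y = P O O * Y O O + sumN n (fun s => P O (S s) * Y O (S s))
    + sumN n (fun r => P (S r) O * Y (S r) O) + frob n (fun r s => P (S r) (S s)) (fun r s => Y (S r) (S s)).
Proof.
  unfold frob. rewrite sumN_head, sumN_head.
  rewrite (sumN_ext n (fun k => sumN (S n) _) (fun r => P (S r) O * Y (S r) O +
    sumN n (fun s => P (S r) (S s) * Y (S r) (S s)))).
  - rewrite sumN_plus. ring.
  - intros r _. apply sumN_head.
Qed.

Lemma psd_zero_diag n Z : psd (S n) Z -> Z n n = 0 ->
  forall r, (r <= n)%nat -> Z r n = 0.
Proof.
  intros [Hs Hq] Hz r Hr. destruct (PeanoNat.Nat.eq_dec r n) as [->|Hn]; auto.
  assert (Hr' : (r < n)%nat) by lia.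
  (* The quadratic form at t e_n + e_r is 2 t Z_rn + Z_rr, affine in t. *)
  pose (e i k := if Nat.eqb k i then 1 else 0).
  assert (Ee : forall i j, (i < S n)%nat -> (j < S n)%nat ->
    frob (S n) Z (outer (e i) (e j)) = Z i j).
  { intros i j Hi Hj. unfold frob, outer, e.
    rewrite (sumN_single (S n) _ i); auto.
    - rewrite (sumN_single (S n) _ j); auto.
      + rewrite !PeanoNat.Nat.eqb_refl. ring.
      + intros k _ Hk. apply PeanoNat.Nat.eqb_neq in Hk. rewrite Hk. ring.
    - intros k _ Hk. apply PeanoNat.Nat.eqb_neq in Hk. apply sumN_zero. intros. rewrite Hk. ring. }
  assert (Q : forall t, 0 <= Z r r + 2 * t * Z r n).
  { intros t. specialize (Hq (fun k => e r k + t * e n k)).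
    rewrite quad_line, !quad_frob, dot_matvec, !Ee, Hz in Hq by (auto; lia). lra. }
  destruct (Req_dec (Z r n) 0) as [|Hne]; auto.
  (* This t makes the affine expression equal to -1. *)
  specialize (Q (- (Z r r + 1) / (2 * Z r n))).
  replace (2 * (- (Z r r + 1) / (2 * Z r n)) * Z r n) with (- (Z r r + 1)) in Q
    by (field; auto). lra.
Qed.

(* Splits Z into the rank-one part of its last column and the Schur complement of Z n n; when
   Z n n = 0 the last column vanishes as well, so the junk value 1/0 is harmless. *)
Lemma frob_psd_nonneg n : forall P Z, psd n P -> psd n Z -> 0 <= frob n P Z.
Proof.
  induction n as [|n IH]; intros P Z HP HZ; [unfold frob; simpl; lra|].
  destruct HP as [HPs HPq]. pose proof HZ as [HZs HZq].
  pose (z r := Z r n). pose (w := / Z n n).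
  pose (S' r s := 1 * Z r s + - w * outer z z r s).
  assert (Hdiag : 0 <= Z n n).
  { specialize (HZq (fun k => if Nat.eqb k n then 1 else 0)).
    rewrite quad_frob in HZq. unfold frob, outer in HZq.
    rewrite (sumN_single (S n) _ n) in HZq; auto.
    - rewrite (sumN_single (S n) _ n) in HZq; auto.
      + rewrite PeanoNat.Nat.eqb_refl in HZq. lra.
      + intros k _ Hk. apply PeanoNat.Nat.eqb_neq in Hk. rewrite Hk. ring.
    - intros k _ Hk. apply PeanoNat.Nat.eqb_neq in Hk. apply sumN_zero. intros. rewrite Hk. ring. }
  assert (Hlast : forall r, (r <= n)%nat -> S' r n = 0).
  { intros r Hr. unfold S', outer, z, w. destruct (Req_dec (Z n n) 0) as [H0|H0].
    - rewrite (psd_zero_diag n Z HZ H0 r Hr). ring.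
    - field. auto. }
  assert (Hsym : symmetric (S n) S').
  { intros r s Hr Hs. unfold S', outer. rewrite (HZs r s) by easy. ring. }
  assert (Hw : 0 <= w).
  { unfold w. destruct (Req_dec (Z n n) 0) as [->|H0].
    - rewrite Rinv_0; lra.
    - left. apply Rinv_0_lt_compat. lra. }
  assert (HS' : psd n S').
  { split; [intros r s Hr Hs; apply Hsym; lia|]. intros v.
    (* complete v by the last coordinate that minimises the form *)
    pose (d := dot n z v).
    pose (u k := if Nat.eqb k n then - w * d else v k).
    assert (E : quad (S n) S' u = quad n S' v).
    { rewrite !quad_frob, frob_S, Hlast by auto.
      rewrite !sumN_zero.
      - rewrite (frob_ext n S' S' (outer u u) (outer v v)); [ring|auto|].
        intros r s Hr Hs. unfold outer, u.
        destruct (PeanoNat.Nat.eqb_spec r n), (PeanoNat.Nat.eqb_spec s n); try lia. reflexivity.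
      - intros k Hk. rewrite Hsym, Hlast by lia. ring.
      - intros k Hk. rewrite Hlast by lia. ring. }
    assert (E2 : quad (S n) S' u = quad (S n) Z u - w * (dot (S n) z u * dot (S n) z u)).
    { rewrite (quad_frob (S n) S' u). unfold S'. rewrite frob_lin_l, <- quad_frob.
      replace (frob (S n) (outer z z) (outer u u)) with (dot (S n) z u * dot (S n) z u)
        by (symmetry; apply frob_outer_outer). ring. }
    (* If [Z n n] is nonzero, the last coordinate of [u] makes z.u vanish; otherwise w = 0. *)
    assert (E3 : w * (dot (S n) z u * dot (S n) z u) = 0).
    { assert (dot (S n) z u = d + Z n n * (- w * d)) as ->.
      { unfold dot; simpl. unfold u at 2, z at 2. rewrite PeanoNat.Nat.eqb_refl. f_equal.
        apply sumN_ext; intros k Hk. unfold u.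
        destruct (PeanoNat.Nat.eqb_spec k n); [lia|reflexivity]. }
      unfold w. destruct (Req_dec (Z n n) 0) as [->|H0]; [rewrite Rinv_0; ring|field; auto]. }
    rewrite <- E, E2, E3. specialize (HZq u). lra. }
  assert (HPn : psd n P).
  { split; [intros r s Hr Hs; apply HPs; lia|]. intros v.
    pose (u k := if Nat.eqb k n then 0 else v k).
    specialize (HPq u). rewrite quad_frob, frob_S in HPq.
    rewrite !sumN_zero in HPq.
    - rewrite quad_frob. rewrite (frob_ext n P P (outer v v) (outer u u)); auto.
      + unfold outer at 2, u in HPq. rewrite PeanoNat.Nat.eqb_refl in HPq.
        unfold u. lra.
      + intros r s Hr Hs. unfold outer, u.
        destruct (PeanoNat.Nat.eqb_spec r n), (PeanoNat.Nat.eqb_spec s n); try lia. reflexivity.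
    - intros k Hk. unfold outer, u. rewrite PeanoNat.Nat.eqb_refl. ring.
    - intros k Hk. unfold outer, u. rewrite PeanoNat.Nat.eqb_refl. ring. }
  (* Z is S' plus w z z^T, and S' has zero last row and column: the first part falls to the
     induction hypothesis, the second is a value of the form of P. *)
  assert (E : frob (S n) P Z = frob n P S' + w * quad (S n) P z).
  { rewrite (frob_ext (S n) P P Z (fun r s => 1 * S' r s + w * outer z z r s)), frob_lin_r, <- quad_frob.
    - rewrite frob_S, Hlast by auto. rewrite !sumN_zero; [ring| |].
      + intros k Hk. rewrite Hsym, Hlast by lia. ring.
      + intros k Hk. rewrite Hlast by lia. ring.
    - auto.
    - intros r s _ _. unfold S'. ring. }
  rewrite E. pose proof (IH P S' HPn HS'). pose proof (HPq z). nra.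
Qed.

Lemma Rabs_sumN_le n f : Rabs (sumN n f) <= sumN n (fun k => Rabs (f k)).
Proof.
  induction n as [|n IH]; simpl; [rewrite Rabs_R0; lra|].
  eapply Rle_trans; [apply Rabs_triang|]. lra.
Qed.

Lemma quad_bound n M : exists C, 0 <= C /\ forall v, Rabs (quad n M v) <= C * dot n v v.
Proof.
  exists (sumN n (fun r => sumN n (fun s => Rabs (M r s)))). split.
  - apply sumN_nonneg; intros r _. apply sumN_nonneg; intros s _. apply Rabs_pos.
  - intros v. rewrite quad_frob. unfold frob.
    eapply Rle_trans; [apply Rabs_sumN_le|].
    rewrite Rmult_comm, <- sumN_scal. apply sumN_le; intros r Hr.
    eapply Rle_trans; [apply Rabs_sumN_le|].
    rewrite <- sumN_scal. apply sumN_le; intros s Hs.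
    rewrite Rabs_mult, Rmult_comm. apply Rmult_le_compat_r; [apply Rabs_pos|].
    pose proof (dot_self_coord n v r Hr). pose proof (dot_self_coord n v s Hs).
    unfold outer. apply Rabs_le. split; nra.
Qed.

(** * Compactness in R^n *)

Lemma Un_cv_subseq u l phi : (forall n, (n <= phi n)%nat) -> Un_cv u l ->
  Un_cv (fun n => u (phi n)) l.
Proof.
  intros H Hu eps He. destruct (Hu eps He) as [n0 Hn0]. exists n0. intros n Hn.
  apply Hn0. specialize (H n). lia.
Qed.

Lemma Un_cv_const c : Un_cv (fun _ => c) c.
Proof. intros eps He. exists O. intros n _. now rewrite Rdist_eq. Qed.

Lemma Un_cv_sumN n f l : (forall k, (k < n)%nat -> Un_cv (fun j => f j k) (l k)) ->
  Un_cv (fun j => sumN n (f j)) (sumN n l).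
Proof.
  induction n as [|n IH]; intros H; simpl; [apply Un_cv_const|].
  apply (CV_plus (fun j => sumN n (f j)) (fun j => f j n)); auto with arith.
Qed.

Lemma inv_INR_lt eps : 0 < eps -> exists n0, forall n, (n0 <= n)%nat -> / (INR n + 1) < eps.
Proof.
  intros He. destruct (archimed_cor1 eps He) as [n0 [H H0]]. exists n0. intros n Hn.
  eapply Rle_lt_trans; [|exact H].
  apply Rinv_le_contravar; [now apply lt_0_INR|]. apply le_INR in Hn. lra.
Qed.

Lemma Un_cv_le_inv u l c : Un_cv u l -> (forall n, u n <= c + / (INR n + 1)) -> l <= c.
Proof.
  intros Hu H. apply Rnot_lt_le. intros Hlt.
  destruct (Hu ((l - c) / 2)) as [n0 Hn0]; [lra|].
  destruct (inv_INR_lt ((l - c) / 2)) as [n1 Hn1]; [lra|].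
  specialize (Hn0 (max n0 n1)). specialize (Hn1 (max n0 n1)). specialize (H (max n0 n1)).
  assert (D := Hn0 ltac:(lia)). assert (D1 := Hn1 ltac:(lia)).
  unfold Rdist in D. apply Rabs_def2 in D. lra.
Qed.

(** The condition n <= phi n stands in for monotonicity: it survives composition and suffices for
    limits to pass to the subsequence. *)
Lemma bounded_subseq (u : nat -> R) M : (forall n, Rabs (u n) <= M) ->
  exists phi l, (forall n, (n <= phi n)%nat) /\ Un_cv (fun n => u (phi n)) l.
Proof.
  intros HM.
  destruct (Bolzano_Weierstrass u (fun c => - M <= c <= M)) as [l Hl].
  - apply compact_P3.
  - intros n. specialize (HM n).
    pose proof (Rle_abs (u n)). pose proof (Rle_abs (- u n)). rewrite Rabs_Ropp in *. lra.
  - assert (H : forall n, exists p, (n <= p)%nat /\ Rabs (u p - l) < / (INR n + 1)).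
    { intros n. assert (Hp : 0 < / (INR n + 1)).
      { apply Rinv_0_lt_compat. pose proof (pos_INR n). lra. }
      destruct (Hl (disc l (mkposreal _ Hp)) n) as [p [Hp1 Hp2]].
      - exists (mkposreal _ Hp). now intros x Hx.
      - now exists p. }
    exists (fun n => proj1_sig (constructive_indefinite_description _ (H n))), l.
    split.
    + intros n. exact (proj1 (proj2_sig (constructive_indefinite_description _ (H n)))).
    + intros eps He. destruct (inv_INR_lt eps He) as [n0 Hn0]. exists n0. intros n Hn.
      pose proof (proj2 (proj2_sig (constructive_indefinite_description _ (H n)))) as Hp.
      unfold Rdist. specialize (Hn0 n Hn). lra.
Qed.

Lemma bounded_subseq_vec n (u : nat -> nat -> R) M :
  (forall j k, (k < n)%nat -> Rabs (u j k) <= M) ->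
  exists phi l, (forall j, (j <= phi j)%nat) /\
    forall k, (k < n)%nat -> Un_cv (fun j => u (phi j) k) (l k).
Proof.
  induction n as [|n IH]; intros HM.
  - exists (fun j => j), (fun _ => 0). split; auto. intros k Hk; lia.
  - destruct IH as [phi [l [Hphi Hl]]]; [auto with arith|].
    destruct (bounded_subseq (fun j => u (phi j) n) M) as [psi [x [Hpsi Hx]]]; [auto|].
    exists (fun j => phi (psi j)), (fun k => if Nat.eqb k n then x else l k). split.
    + intros j. specialize (Hphi (psi j)). specialize (Hpsi j). lia.
    + intros k Hk. destruct (PeanoNat.Nat.eqb_spec k n) as [->|Hn]; auto.
      apply (Un_cv_subseq (fun j => u (phi j) k)); auto. apply Hl. lia.
Qed.

Lemma Un_cv_dot n u v l l' :
  (forall k, (k < n)%nat -> Un_cv (fun j => u j k) (l k)) ->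
  (forall k, (k < n)%nat -> Un_cv (fun j => v j k) (l' k)) ->
  Un_cv (fun j => dot n (u j) (v j)) (dot n l l').
Proof.
  intros H H'. unfold dot.
  apply (Un_cv_sumN n (fun j k => u j k * v j k) (fun k => l k * l' k)).
  intros k Hk. apply (CV_mult (fun j => u j k) (fun j => v j k)); auto.
Qed.

Lemma Un_cv_quad n M u l :
  (forall k, (k < n)%nat -> Un_cv (fun j => u j k) (l k)) ->
  Un_cv (fun j => quad n M (u j)) (quad n M l).
Proof.
  intros H. unfold quad. apply (Un_cv_dot n u (fun j => matvec n M (u j))); auto.
  intros k Hk. unfold matvec. apply (Un_cv_dot n (fun _ => M k) u); auto.
  intros; apply Un_cv_const.
Qed.

(* Normalised counterexamples for mu = 1/(j+1) would accumulate at a unit vector where the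
   form is nonpositive. *)
Lemma pd_coercive n M : pd n M -> exists mu, 0 < mu /\ forall v, mu * dot n v v <= quad n M v.
Proof.
  intros [_ HM]. apply NNPP. intros Hn.
  assert (H : forall j, exists v, dot n v v = 1 /\ quad n M v <= 0 + / (INR j + 1)).
  { intros j. apply NNPP. intros Hj. apply Hn. exists (/ (INR j + 1)). split.
    { apply Rinv_0_lt_compat. pose proof (pos_INR j). lra. }
    intros v. destruct (Req_dec (dot n v v) 0) as [H0|H0].
    - rewrite H0. apply dot_self_eq0 in H0.
      unfold quad. rewrite dot_zero_l by easy. lra.
    - pose proof (dot_self_nonneg n v). set (d := dot n v v) in *.
      assert (Hs : 0 < sqrt d) by (apply sqrt_lt_R0; lra).
      assert (Hsd : sqrt d * sqrt d = d) by (apply sqrt_sqrt; lra).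
      apply Rnot_lt_le. intros Hlt. apply Hj.
      exists (fun k => / sqrt d * v k).
      assert (Hi : / d = / sqrt d * / sqrt d) by (rewrite <- Rinv_mult; congruence).
      assert (E1 : dot n (fun k => / sqrt d * v k) (fun k => / sqrt d * v k) = / d * d).
      { rewrite Hi. unfold d at 5. unfold dot at 1 2. rewrite <- sumN_scal.
        apply sumN_ext; intros; ring. }
      assert (E2 : quad n M (fun k => / sqrt d * v k) = / d * quad n M v).
      { rewrite Hi, !quad_frob.
        rewrite (frob_ext n M M _ (fun r s => (/ sqrt d * / sqrt d) * outer v v r s + 0 * outer v v r s)).
        - rewrite frob_lin_r. ring.
        - auto.
        - intros; unfold outer. ring. }
      split.
      + rewrite E1. field. lra.
      + rewrite E2. assert (0 < / d) by (apply Rinv_0_lt_compat; lra).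
        apply Rmult_le_reg_l with d; [lra|]. rewrite <- Rmult_assoc, Rinv_r by lra. lra. }
  pose (u j := proj1_sig (constructive_indefinite_description _ (H j))).
  assert (Hu : forall j, dot n (u j) (u j) = 1 /\ quad n M (u j) <= 0 + / (INR j + 1)).
  { intros j. exact (proj2_sig (constructive_indefinite_description _ (H j))). }
  destruct (bounded_subseq_vec n u 1) as [phi [l [Hphi Hl]]].
  { intros j k Hk. pose proof (dot_self_coord n (u j) k Hk) as Hd.
    rewrite (proj1 (Hu j)) in Hd. apply Rabs_le. split; nra. }
  assert (D : dot n l l = 1).
  { apply (UL_sequence (fun j => dot n (u (phi j)) (u (phi j)))).
    - now apply Un_cv_dot.
    - intros eps He. exists O. intros j _. rewrite (proj1 (Hu (phi j))). now rewrite Rdist_eq. }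
  assert (Q : quad n M l <= 0).
  { apply (Un_cv_le_inv (fun j => quad n M (u (phi j)))).
    - now apply Un_cv_quad.
    - intros j. eapply Rle_trans; [apply Hu|]. apply Rplus_le_compat_l.
      apply Rinv_le_contravar; [pose proof (pos_INR j); lra|].
      specialize (Hphi j). apply le_INR in Hphi. lra. }
  assert (0 < quad n M l); [|lra].
  apply HM. apply NNPP. intros Hz.
  assert (vzero n l).
  { intros k Hk. apply NNPP. intros Hk'. apply Hz. now exists k. }
  rewrite dot_zero_l in D by easy. lra.
Qed.

(** * Linear functionals on cones, small steps and perturbed definite matrices *)

Lemma cone_dot_zero n (P : (nat -> R) -> Prop) a y :
  (forall d, P d -> dot n a d = 0) -> cone n P y -> dot n a y = 0.
Proof.
  intros H Hy.
  assert (dot n a y <= 0) by (apply (cone_dot_nonpos n P); auto; intros d Hd; rewrite H; auto; lra).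
  assert (dot n (fun k => (-1) * a k + 0 * a k) y <= 0).
  { apply (cone_dot_nonpos n P); auto. intros d Hd. rewrite dot_lin_l, H; auto; lra. }
  rewrite dot_lin_l in H1. lra.
Qed.

Lemma sumN_dot n m y f u :
  sumN n (fun s => dot m y (fun k => f k s) * u s)
  = dot m y (fun k => sumN n (fun s => f k s * u s)).
Proof.
  unfold dot. rewrite (sumN_ext m _ (fun k => sumN n (fun s => y k * f k s * u s))).
  - rewrite sumN_exchange. apply sumN_ext; intros s _.
    rewrite Rmult_comm, <- sumN_scal. apply sumN_ext; intros k _. ring.
  - intros k _. rewrite <- sumN_scal. apply sumN_ext; intros s _. ring.
Qed.

(** Each threshold covers all smaller steps, so the minimum over the finite list serves every
    generator at once. *)
Lemma list_uniform_step (P : (nat -> R) -> R -> Prop) l :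
  (forall d, In d l -> exists e0, 0 < e0 /\ forall e, 0 < e <= e0 -> P d e) ->
  exists e0, 0 < e0 /\ forall d, In d l -> P d e0.
Proof.
  intros H.
  assert (exists e0, 0 < e0 /\ forall e, 0 < e <= e0 -> forall d, In d l -> P d e) as [e0 [He Hl]].
  { induction l as [|d l IH].
    - exists 1. split; [lra|easy].
    - destruct IH as [e1 [He1 H1]]; [intros; apply H; now right|].
      destruct (H d) as [e2 [He2 H2]]; [now left|].
      exists (Rmin e1 e2). split; [now apply Rmin_pos|].
      intros e He d' [<-|Hd'].
      + apply H2. pose proof (Rmin_r e1 e2). lra.
      + apply H1; auto. pose proof (Rmin_l e1 e2). lra. }
  exists e0. split; auto. apply Hl. lra.
Qed.

(** Strict slack absorbs the first- and second-order terms of a short step. The bound e <= 1 reduces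
    the quadratic term to a linear one, and e <= - eta / B then controls both. *)
Lemma small_step_neg eta beta kappa : eta < 0 ->
  exists e0, 0 < e0 /\ forall e, 0 < e <= e0 -> eta + e * beta + e * e * kappa <= 0.
Proof.
  intros He. pose proof (Rabs_pos beta). pose proof (Rabs_pos kappa).
  set (B := Rabs beta + Rabs kappa + 1). assert (HB : 0 < B) by (unfold B; lra).
  exists (Rmin 1 (- eta / B)). split.
  - apply Rmin_pos; [lra|]. apply Rdiv_lt_0_compat; lra.
  - intros e [He0 He1].
    pose proof (Rle_trans _ _ _ He1 (Rmin_l _ _)) as H1.
    pose proof (Rle_trans _ _ _ He1 (Rmin_r _ _)) as H2.
    assert (e * B <= - eta).
    { apply Rmult_le_compat_r with (r := B) in H2; [|lra].
      unfold Rdiv in H2. rewrite Rmult_assoc, Rinv_l in H2; lra. }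
    pose proof (Rle_abs beta). pose proof (Rle_abs kappa).
    assert (e * beta <= e * Rabs beta) by nra.
    assert (e * kappa <= Rabs kappa) by nra.
    assert (e * (e * kappa) <= e * Rabs kappa) by (apply Rmult_le_compat_l; lra).
    unfold B in *. nra.
Qed.

Lemma pd_ext n M M' : (forall r s, M r s = M' r s) -> pd n M -> pd n M'.
Proof.
  intros H HM. replace M' with M; auto.
  apply functional_extensionality; intros r. apply functional_extensionality; intros s. apply H.
Qed.

Lemma psd_ext n M M' : (forall r s, M r s = M' r s) -> psd n M -> psd n M'.
Proof.
  intros H HM. replace M' with M; auto.
  apply functional_extensionality; intros r. apply functional_extensionality; intros s. apply H.
Qed.

Lemma pd_psd n M : pd n M -> psd n M.
Proof.
  intros HM. split; [apply HM|]. intros v.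
  destruct (pd_coercive n M HM) as [mu [Hmu H]]. specialize (H v).
  pose proof (dot_self_nonneg n v). nra.
Qed.

(** The form of M is at least mu |v|^2 and that of B at most C |v|^2 in absolute value; dividing by
    C + 1 rather than C covers C = 0. *)
Lemma psd_perturb n M B : pd n M -> symmetric n B ->
  exists e0, 0 < e0 /\ forall e, Rabs e <= e0 -> psd n (fun r s => M r s + e * B r s).
Proof.
  intros HM HB. destruct (pd_coercive n M HM) as [mu [Hmu Hq]].
  destruct (quad_bound n B) as [C [HC HCq]].
  exists (mu / (C + 1)). split; [apply Rdiv_lt_0_compat; lra|].
  intros e He. split.
  - intros r s Hr Hs. rewrite (proj1 HM r s), (HB r s) by easy. reflexivity.
  - intros v. rewrite quad_frob.
    rewrite (frob_ext n _ (fun r s => 1 * M r s + e * B r s) (outer v v) (outer v v)), frob_lin_l, <- !quad_frob;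
      [|intros; ring|auto].
    specialize (Hq v). specialize (HCq v). pose proof (dot_self_nonneg n v).
    assert (H1 : Rabs e * Rabs (quad n B v) <= mu / (C + 1) * (C * dot n v v)).
    { apply Rmult_le_compat; auto using Rabs_pos. }
    assert (H2 : mu / (C + 1) * C <= mu).
    { apply Rmult_le_reg_r with (C + 1); [lra|]. field_simplify; [nra|lra]. }
    pose proof (Rle_abs (- (e * quad n B v))) as H3. rewrite Rabs_Ropp, Rabs_mult in H3.
    assert (mu / (C + 1) * C * dot n v v <= mu * dot n v v) by nra.
    lra.
Qed.

(* [hom g] is the point (1, g) of R^{1+m}; a polyhedron in R^m is the slice y_0 = 1
   of a cone in R^{1+m}, and [dehom] goes back. *)
Definition hom (g : nat -> R) : nat -> R := fun k => match k with O => 1 | S _ => g k end.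
Definition dehom (m : nat) (y : nat -> R) : nat -> R :=
  fun k => match k with O => 0 | S _ => if Nat.leb k m then y k else 0 end.

Lemma dehom_in_Rm m y : in_Rm m (dehom m y).
Proof.
  split; [reflexivity|]. intros [|k] Hk; [reflexivity|]. unfold dehom.
  destruct (PeanoNat.Nat.leb_spec (S k) m); [lia|reflexivity].
Qed.

Lemma hom_dehom m y : y O = 1 -> veq (S m) (hom (dehom m y)) y.
Proof.
  intros H0 [|k] Hk; [now rewrite H0|].
  change (dehom m y (S k) = y (S k)). unfold dehom.
  destruct (PeanoNat.Nat.leb_spec (S k) m); [reflexivity|lia].
Qed.

Lemma hom_comb t u v : hom (comb t u v) = fun k => t * hom u k + (1 - t) * hom v k.
Proof. apply functional_extensionality. intros [|k]; unfold hom, comb; ring. Qed.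

Lemma polyhedron_cone m C : polyhedron m C ->
  exists D : list (nat -> R), (forall d, In d D -> 0 <= d O) /\
    forall g, C g <-> in_Rm m g /\ cone (S m) (fun d => In d D) (hom g).
Proof.
  intros [K [a [beta HC]]].
  (* Row l < K is the homogenised inequality a_l.y <= beta_l y_0; the extra row K is y_0 >= 0, which
     gives the sign of [d O] on generators. *)
  pose (ineq l k := if Nat.ltb l K then match k with O => - beta l | S _ => a l k end
                    else match k with O => -1 | S _ => 0 end).
  destruct (finite_inequalities_cone (S m) ineq (S K)) as [D HD]. exists D. split.
  - intros d Hd. pose proof (proj1 (HD d) (cone_gen _ _ _ Hd) K (PeanoNat.Nat.lt_succ_diag_r K)) as H.
    rewrite dot_head in H. unfold ineq in H. rewrite PeanoNat.Nat.ltb_irrefl in H.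
    rewrite (dot_zero_l m (fun k => 0)) in H by (now intros k _). lra.
  - intros g. rewrite HC, HD.
    assert (E : forall l, (l < K)%nat ->
      dot (S m) (ineq l) (hom g) = sumN m (fun k => a l (S k) * g (S k)) - beta l).
    { intros l Hl. rewrite dot_head. unfold ineq. apply PeanoNat.Nat.ltb_lt in Hl.
      rewrite Hl. simpl. unfold dot. ring. }
    split; intros [Hg H]; split; auto; intros l Hl.
    + destruct (PeanoNat.Nat.eq_dec l K) as [->|Hn].
      * rewrite dot_head. unfold ineq. rewrite PeanoNat.Nat.ltb_irrefl.
        rewrite (dot_zero_l m (fun k => 0)) by (now intros k _). simpl. lra.
      * rewrite E by lia. specialize (H l). assert (l < K)%nat by lia. specialize (H H0). lra.
    + specialize (H l). rewrite E in H by auto. specialize (H ltac:(lia)). lra.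
Qed.

Definition pack (s : R) (v : nat -> R) : nat -> R := fun k => match k with O => s | S k' => v k' end.

(** * The minimax problem *)

Section Lagrangian.
Variables (N mI mE : nat) (A : nat -> nat -> nat -> R) (b : nat -> nat -> R) (c : nat -> R).
Let m := (mI + mE)%nat.
Hypothesis Hsym : forall i, (i <= m)%nat -> symmetric N (A i).

(* Homogenised data: y = (y_0, gamma) weighs the index-0 data by y_0, so y_0 = 1 gives A(gamma),
   b(gamma) and the Lagrangian, while y_0 = 0 gives their recession parts. *)
Definition hA (y : nat -> R) : nat -> nat -> R := fun r s => dot (S m) y (fun k => A k r s).
Definition hb (y : nat -> R) : nat -> R := fun r => dot (S m) y (fun k => b k r).
Definition hL (y x : nat -> R) : R := dot (S m) y (fun k => qf N A b c k x).
(** States that the supremum of L(gamma, x) over Gamma is at most t, without requiring it to be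
    finite or attained. *)
Definition dual_value_le (x : nat -> R) (t : R) : Prop :=
  forall g, Gamma N A mI mE g -> hL (hom g) x <= t.

Lemma hA_hom g r s : hA (hom g) r s = Agam A m g r s.
Proof. unfold hA. rewrite dot_head. unfold Agam, dot. simpl. ring. Qed.

Lemma hb_hom g r : hb (hom g) r = bgam b m g r.
Proof. unfold hb. rewrite dot_head. unfold bgam, dot. simpl. ring. Qed.

Lemma hL_hom g x : hL (hom g) x = qf N A b c 0 x + sumN m (fun k => g (S k) * qf N A b c (S k) x).
Proof. unfold hL. rewrite dot_head. unfold dot. simpl. ring. Qed.

Lemma hA_matvec y u r :
  matvec N (hA y) u r = dot (S m) y (fun k => matvec N (A k) u r).
Proof. apply sumN_dot. Qed.

Lemma hb_dot y u : dot N (hb y) u = dot (S m) y (fun k => dot N (b k) u).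
Proof. apply (sumN_dot N (S m) y b). Qed.

Lemma hA_dot_matvec y u v :
  dot N u (matvec N (hA y) v) = dot (S m) y (fun k => dot N u (matvec N (A k) v)).
Proof.
  rewrite (dot_ext N u u _ (fun r => dot (S m) y (fun k => matvec N (A k) v r))).
  - rewrite dot_sym. unfold dot at 1.
    rewrite (sumN_dot N (S m) y (fun k => matvec N (A k) v) u).
    apply dot_ext; intros k _; [reflexivity|]. apply (dot_sym N).
  - now intros r _.
  - intros r _. apply hA_matvec.
Qed.

Lemma hA_sym y : symmetric N (hA y).
Proof.
  intros r s Hr Hs. apply dot_ext; [now intros k _|]. intros k Hk. apply Hsym; auto; lia.
Qed.

Lemma hL_quad y x :
  hL y x = quad N (hA y) x + 2 * dot N (hb y) x + dot (S m) y c.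
Proof.
  unfold hL, quad. rewrite hA_dot_matvec, hb_dot.
  rewrite (dot_ext (S m) y y _ (fun k => 1 * (1 * dot N x (matvec N (A k) x) + 2 * dot N (b k) x) + 1 * c k)).
  - rewrite !dot_lin_r. ring.
  - now intros k _.
  - intros k _. unfold qf, quad. ring.
Qed.

Lemma hL_line y x e v :
  hL y (fun k => x k + e * v k) =
  hL y x + 2 * e * (dot N x (matvec N (hA y) v) + dot N (hb y) v) + e * e * quad N (hA y) v.
Proof.
  rewrite !hL_quad, quad_line by apply hA_sym.
  rewrite (dot_ext N (hb y) (hb y) (fun k => x k + e * v k) (fun k => 1 * x k + e * v k)).
  - rewrite dot_lin_r. ring.
  - now intros k _.
  - intros k _. ring.
Qed.

Lemma hL_cv y u l : (forall k, (k < N)%nat -> Un_cv (fun j => u j k) (l k)) ->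
  Un_cv (fun j => hL y (u j)) (hL y l).
Proof.
  intros H. unfold hL.
  apply (Un_cv_dot (S m) (fun _ => y) (fun j k => qf N A b c k (u j))).
  - intros; apply Un_cv_const.
  - intros k _. unfold qf.
    apply (CV_plus (fun j => quad N (A k) (u j) + 2 * dot N (b k) (u j)) (fun _ => c k));
      [|apply Un_cv_const].
    apply (CV_plus (fun j => quad N (A k) (u j)) (fun j => 2 * dot N (b k) (u j)));
      [now apply Un_cv_quad|].
    apply (CV_mult (fun _ => 2) (fun j => dot N (b k) (u j))); [apply Un_cv_const|].
    apply (Un_cv_dot N (fun _ => b k) u); auto. intros; apply Un_cv_const.
Qed.

Lemma hL_coercive y : pd N (hA y) ->
  exists mu C, 0 < mu /\ forall x, mu * dot N x x <= hL y x + C.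
Proof.
  intros Hpd. destruct (pd_coercive N _ Hpd) as [mu [Hmu Hq]].
  exists (mu / 2), (2 / mu * dot N (hb y) (hb y) - dot (S m) y c). split; [lra|].
  intros x. rewrite hL_quad. specialize (Hq x).
  (* With this weight the linear term costs half of the quadratic one. The vector is - x, in the
     shape that the bilinearity lemmas rewrite. *)
  pose proof (dot_young N (2 / mu) (hb y) (fun k => (-1) * x k + 0 * x k)) as Hy.
  rewrite !dot_lin_r, !dot_lin_l in Hy.
  assert (H2 : 0 < 2 / mu) by (apply Rdiv_lt_0_compat; lra). specialize (Hy H2).
  replace (/ (2 / mu)) with (mu / 2) in Hy by (field; lra). lra.
Qed.

(* At a point whose active multiplier is definite, every coordinate of the multiplier can be
   moved a little inside Gamma; this recovers primal feasibility and complementarity. *)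
Lemma feasible_of_definite_multiplier g x t :
  Gamma N A mI mE g -> pd N (Agam A m g) -> dual_value_le x t -> hL (hom g) x = t ->
  qcqp_feasible N A b c mI mE x /\ qf N A b c 0 x = t.
Proof.
  intros [[Hg0 Hgm] [Hgpsd Hgpos]] Hpd Hsup Heq.
  assert (Hmove : forall i, (1 <= i <= m)%nat -> exists e0, 0 < e0 /\
    forall e, Rabs e <= e0 -> ((i <= mI)%nat -> 0 <= g i + e) -> e * qf N A b c i x <= 0).
  { intros i Hi. destruct (psd_perturb N _ (A i) Hpd) as [e0 [He0 H]]; [apply Hsym; lia|].
    exists e0. split; auto. intros e He Hge. specialize (H e He).
    pose (g' k := g k + (if Nat.eqb k i then e else 0)).
    assert (E : forall f, dot (S m) (hom g') f = dot (S m) (hom g) f + e * f i).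
    { intros f.
      rewrite (dot_ext (S m) (hom g') (fun k => 1 * hom g k + e * (if Nat.eqb k i then 1 else 0)) f f).
      - rewrite dot_lin_l. unfold dot at 2. rewrite (sumN_single (S m) _ i).
        + rewrite PeanoNat.Nat.eqb_refl. ring.
        + lia.
        + intros k _ Hk. apply PeanoNat.Nat.eqb_neq in Hk. rewrite Hk. ring.
      - intros [|k] Hk; unfold hom, g'.
        + destruct (PeanoNat.Nat.eqb_spec 0 i); [lia|ring].
        + destruct (PeanoNat.Nat.eqb (S k) i); ring.
      - now intros k _. }
    assert (HG : Gamma N A mI mE g').
    { split; [|split].
      - split.
        + unfold g'. rewrite Hg0. destruct (PeanoNat.Nat.eqb_spec 0 i); [lia|ring].
        + intros k Hk. unfold g'. rewrite Hgm by auto.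
          destruct (PeanoNat.Nat.eqb_spec k i); [unfold m in *; lia|ring].
      - revert H. apply psd_ext. intros r s.
        rewrite <- (hA_hom g'), <- hA_hom. unfold hA. now rewrite E.
      - intros k Hk. unfold g'. destruct (PeanoNat.Nat.eqb_spec k i) as [->|].
        + apply Hge. lia.
        + specialize (Hgpos k Hk). lra. }
    specialize (Hsup g' HG). unfold hL in Hsup, Heq. rewrite E, Heq in Hsup. lra. }
  assert (Hle : forall i, (1 <= i <= m)%nat -> qf N A b c i x <= 0).
  { intros i Hi. destruct (Hmove i Hi) as [e0 [He0 H]].
    assert (e0 * qf N A b c i x <= 0); [|nra].
    apply H; [rewrite Rabs_pos_eq; lra|]. intros Hi'.
    specialize (Hgpos i (conj (proj1 Hi) Hi')). lra. }
  assert (Hge : forall i, (1 <= i <= m)%nat -> ((i <= mI)%nat -> 0 < g i) -> 0 <= qf N A b c i x).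
  { intros i Hi Hpos. destruct (Hmove i Hi) as [e0 [He0 H]].
    (* A downward step in a sign-constrained coordinate may not exceed g i. *)
    pose (e1 := if Nat.leb i mI then Rmin e0 (g i) else e0).
    assert (He1 : 0 < e1 <= e0 /\ ((i <= mI)%nat -> e1 <= g i)).
    { unfold e1. destruct (PeanoNat.Nat.leb_spec i mI) as [Hl|Hl].
      - pose proof (Rmin_l e0 (g i)). pose proof (Rmin_r e0 (g i)).
        repeat split; auto. apply Rmin_pos; auto.
      - repeat split; try lra. lia. }
    assert (- e1 * qf N A b c i x <= 0); [|nra].
    apply H; [rewrite Rabs_Ropp, Rabs_pos_eq; lra|]. intros Hi'.
    destruct He1 as [_ He1]. specialize (He1 Hi'). lra. }
  split.
  - split; intros i Hi.
    + apply Hle. unfold m. lia.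
    + apply Rle_antisym; [apply Hle|apply Hge]; unfold m; lia.
  - rewrite hL_hom, sumN_zero in Heq; [lra|]. intros k Hk.
    destruct (Req_dec (g (S k)) 0) as [->|Hne]; [ring|].
    assert (0 <= qf N A b c (S k) x).
    { apply Hge; [lia|]. intros HI. assert (1 <= S k <= mI)%nat as Hr by lia.
      specialize (Hgpos _ Hr). lra. }
    assert (qf N A b c (S k) x <= 0) by (apply Hle; lia).
    replace (qf N A b c (S k) x) with 0 by lra. ring.
Qed.

(** A minimising sequence is bounded by coercivity at the definite multiplier, and a limit point
    inherits every bound L(gamma, .) <= t by continuity. *)
Lemma dual_value_minimizer g0 x0 t0 :
  Gamma N A mI mE g0 -> pd N (Agam A m g0) -> dual_value_le x0 t0 ->
  exists x t, dual_value_le x t /\ t <= t0 /\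
    forall x' t', dual_value_le x' t' -> t <= t'.
Proof.
  intros Hg0 Hpd Hx0.
  destruct (hL_coercive (hom g0)) as [mu [C [Hmu HC]]].
  { revert Hpd. apply pd_ext. intros; symmetry; apply hA_hom. }
  (* Values are negated, since [completeness] provides suprema. *)
  destruct (completeness (fun s => exists x, dual_value_le x (- s))) as [s [Hub Hlub]].
  - exists C. intros s [x Hx]. specialize (Hx g0 Hg0). specialize (HC x).
    pose proof (dot_self_nonneg N x). nra.
  - exists (- t0), x0. now rewrite Ropp_involutive.
  - assert (H : forall j, exists x, dual_value_le x (- s + / (INR j + 1))).
    { intros j. apply NNPP. intros Hn.
      assert (Hp : 0 < / (INR j + 1)).
      { apply Rinv_0_lt_compat. pose proof (pos_INR j). lra. }
      assert (s <= s - / (INR j + 1)); [|lra]. apply Hlub. intros u [x Hx].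
      apply Rnot_lt_le. intros Hlt. apply Hn. exists x. intros g Hg.
      specialize (Hx g Hg). lra. }
    pose (u j := proj1_sig (constructive_indefinite_description _ (H j))).
    assert (Hu : forall j, dual_value_le (u j) (- s + / (INR j + 1))).
    { intros j. exact (proj2_sig (constructive_indefinite_description _ (H j))). }
    pose (B := / mu * (- s + 1 + C)).
    destruct (bounded_subseq_vec N u (1 + B)) as [phi [x [Hphi Hx]]].
    { intros j k Hk. specialize (Hu j g0 Hg0). specialize (HC (u j)).
      assert (/ (INR j + 1) <= 1).
      { rewrite <- Rinv_1 at 2. apply Rinv_le_contravar; [lra|]. pose proof (pos_INR j). lra. }
      assert (dot N (u j) (u j) <= B).
      { unfold B. apply Rmult_le_reg_l with mu; auto.
        rewrite <- Rmult_assoc, Rinv_r by lra. lra. }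
      pose proof (dot_self_coord N (u j) k Hk). apply Rabs_le. split; nra. }
    assert (Hxs : dual_value_le x (- s)).
    { intros g Hg. apply (Un_cv_le_inv (fun j => hL (hom g) (u (phi j)))).
      - now apply hL_cv.
      - intros j. eapply Rle_trans; [now apply (Hu (phi j))|]. apply Rplus_le_compat_l.
        apply Rinv_le_contravar; [pose proof (pos_INR j); lra|].
        specialize (Hphi j). apply le_INR in Hphi. lra. }
    assert (Hmin : forall x' t', dual_value_le x' t' -> - s <= t').
    { intros x' t' Hx'. assert (- t' <= s); [|lra]. apply Hub. exists x'.
      now rewrite Ropp_involutive. }
    exists x, (- s). split; [|split]; auto. now apply (Hmin x0).
Qed.

Definition active_face (x : nat -> R) (t : R) (g : nat -> R) : Prop :=
  Gamma N A mI mE g /\ hL (hom g) x = t.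

(** * Active faces and optimality in terms of the cone generators *)

Section ConeGenerators.
Variable D : list (nat -> R).
Hypothesis HD0 : forall d, In d D -> 0 <= d O.
Hypothesis HD : forall g, Gamma N A mI mE g <-> in_Rm m g /\ cone (S m) (fun d => In d D) (hom g).

(** The linear functional on R^{1+m} that equals L(gamma, x) - t at (1, gamma). *)
Definition gap (x : nat -> R) (t : R) : nat -> R :=
  fun k => match k with O => qf N A b c 0 x - t | S _ => qf N A b c k x end.

Lemma dot_gap x t y : dot (S m) (gap x t) y = hL y x - y O * t.
Proof. unfold hL. rewrite dot_sym, !dot_head. unfold gap at 1. simpl. unfold gap. ring. Qed.

Lemma Gamma_dehom y : cone (S m) (fun d => In d D) y -> y O = 1 -> Gamma N A mI mE (dehom m y).
Proof.
  intros Hy H0. apply HD. split; [apply dehom_in_Rm|].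
  apply cone_veq with y; auto. now apply hom_dehom.
Qed.

Lemma active_face_dehom x t y : cone (S m) (fun d => In d D) y -> y O = 1 ->
  dot (S m) (gap x t) y = 0 -> active_face x t (dehom m y).
Proof.
  intros Hy H0 Hgap. split; [now apply Gamma_dehom|].
  rewrite dot_gap, H0 in Hgap. unfold hL in *.
  rewrite (dot_ext (S m) _ y _ (fun k => qf N A b c k x)); [lra|now apply hom_dehom|now intros k _].
Qed.

(* The point (hom g + e d) / (1 + e d_0) of the slice y_0 = 1, so that points and rays of the
   generating list are treated alike. *)
Definition blend (g : nat -> R) (e : R) (d : nat -> R) : nat -> R :=
  fun k => / (1 + e * d O) * hom g k + (/ (1 + e * d O) * e) * d k.

Lemma blend_cone g e d : Gamma N A mI mE g -> 0 <= e -> In d D ->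
  cone (S m) (fun d => In d D) (blend g e d) /\ blend g e d O = 1 /\ 0 < / (1 + e * d O).
Proof.
  intros Hg He Hd. pose proof (HD0 d Hd) as H0.
  assert (H1 : 0 < 1 + e * d O) by nra.
  assert (H2 : 0 < / (1 + e * d O)) by now apply Rinv_0_lt_compat.
  split; [|split]; auto.
  - apply cone_lin; [lra|nra|now apply HD|now apply cone_gen].
  - unfold blend, hom. field. lra.
Qed.

(** Reduces the bound over all of Gamma to finitely many inequalities, for points and rays alike. *)
Lemma dual_value_gens x t : (exists g, Gamma N A mI mE g) ->
  (dual_value_le x t <-> forall d, In d D -> dot (S m) (gap x t) d <= 0).
Proof.
  intros [g0 Hg0]. split; intros H.
  - intros d Hd. apply Rnot_lt_le. intros Hlt.
    set (q := dot (S m) (gap x t) d) in *.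
    set (q0 := dot (S m) (gap x t) (hom g0)).
    assert (Hq0 : q0 <= 0).
    { unfold q0. rewrite dot_gap. specialize (H g0 Hg0). unfold hom at 2. lra. }
    (* Enough weight on d to bring the functional at hom g0 + e d to q0 + e q = 1 > 0. *)
    pose (e := (1 - q0) / q).
    assert (He : 0 <= e) by (unfold e; apply Rlt_le, Rdiv_lt_0_compat; lra).
    destruct (blend_cone g0 e d Hg0 He Hd) as [Hc [H0 Hi]].
    assert (Hle : dot (S m) (gap x t) (blend g0 e d) <= 0).
    { rewrite dot_gap, H0. specialize (H _ (Gamma_dehom _ Hc H0)).
      unfold hL in *.
      rewrite (dot_ext (S m) _ (blend g0 e d) _ (fun k => qf N A b c k x)) in H;
        [lra|now apply hom_dehom|now intros k _]. }
    unfold blend in Hle. rewrite dot_lin_r in Hle. fold q q0 in Hle.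
    assert (e * q = 1 - q0) by (unfold e; field; lra). nra.
  - intros g Hg. assert (dot (S m) (gap x t) (hom g) <= 0).
    { apply (cone_dot_nonpos _ (fun d => In d D)); auto. now apply HD. }
    rewrite dot_gap in H0. unfold hom at 2 in H0. lra.
Qed.

(** L is affine in gamma and bounded by t on Gamma, so an interior point of a segment can reach t
    only if both ends do. *)
Lemma active_face_face x t : dual_value_le x t -> face (Gamma N A mI mE) (active_face x t).
Proof.
  intros Hx.
  assert (E : forall s u v, hL (hom (comb s u v)) x = s * hL (hom u) x + (1 - s) * hL (hom v) x).
  { intros s u v. rewrite hom_comb. unfold hL. apply dot_lin_l. }
  split; [now intros u [Hu _]|split].
  - intros u v s [Hu Eu] [Hv Ev] Hs. split.
    + apply HD in Hu, Hv. apply HD. destruct Hu as [[Hu0 Hum] Hu], Hv as [[Hv0 Hvm] Hv].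
      split.
      * split; [unfold comb; rewrite Hu0, Hv0; ring|].
        intros k Hk. unfold comb. rewrite Hum, Hvm by auto. ring.
      * rewrite hom_comb. apply cone_lin; auto; lra.
    + rewrite E, Eu, Ev. ring.
  - intros u v s Hu Hv Hs [_ Huv]. rewrite E in Huv.
    pose proof (Hx u Hu). pose proof (Hx v Hv).
    split; (split; [assumption|]); nra.
Qed.

(** Blending an active gamma with d stays in the active face; u is killed by the matrices of both
    points, hence by that of d. *)
Lemma active_gen_kernel x t d u : In d D -> dot (S m) (gap x t) d = 0 ->
  (exists g, active_face x t g) -> Vspace N A m (active_face x t) u ->
  vzero N (matvec N (hA d) u).
Proof.
  intros Hd Hgap [g [Hg Hgt]] Hu r Hr.
  destruct (blend_cone g 1 d Hg) as [Hc [H0 Hi]]; [lra|auto|].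
  assert (Hb : active_face x t (dehom m (blend g 1 d))).
  { apply active_face_dehom; auto. unfold blend. rewrite dot_lin_r, Hgap, dot_gap, Hgt.
    unfold hom. ring. }
  pose proof (Hu _ Hb r Hr) as E1. pose proof (Hu g (conj Hg Hgt) r Hr) as E2.
  assert (T : forall g', matvec N (Agam A m g') u r = dot (S m) (hom g') (fun k => matvec N (A k) u r)).
  { intros g'. rewrite <- hA_matvec. apply sumN_ext. intros s _. now rewrite hA_hom. }
  rewrite T in E1, E2.
  rewrite (dot_ext (S m) _ (blend g 1 d) _ (fun k => matvec N (A k) u r)) in E1;
    [|now apply hom_dehom|now intros k _].
  unfold blend in E1. rewrite dot_lin_l, E2 in E1. rewrite hA_matvec. nra.
Qed.

Lemma dot_pack s v w : dot (S N) (pack s v) w = s * w O + dot N v (fun k => w (S k)).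
Proof. apply dot_head. Qed.

(* Farkas applied to b(gamma), taken modulo the orthogonal complement of V(F). *)
Lemma descent_alternative (L : list (nat -> R)) :
  (exists y, cone (S m) (fun d => In d L) y /\ y O = 1 /\
     forall u, (forall d, In d L -> vzero N (matvec N (hA d) u)) -> dot N (hb y) u = 0) \/
  (exists v tau, 0 < tau /\
     forall d, In d L -> vzero N (matvec N (hA d) v) /\ d O * tau + dot N (hb d) v <= 0).
Proof.
  (* Farkas is applied to the target (1, 0) with generators (d_0, b(d)) and (0, r), (0, -r) for the
     rows r of A(d). Rows with both signs encode an equality. *)
  pose (gens := map (fun d => pack (d O) (hb d)) L ++
    flat_map (fun d => flat_map (fun r =>
       pack 0 (hA d r) :: pack 0 (fun s => (-1) * hA d r s + 0 * hA d r s) :: nil) (seq 0 N)) L).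
  assert (Hgens : forall z, In z gens <->
    (exists d, In d L /\ z = pack (d O) (hb d)) \/
    (exists d r, In d L /\ (r < N)%nat /\
       (z = pack 0 (hA d r) \/ z = pack 0 (fun s => (-1) * hA d r s + 0 * hA d r s)))).
  { intros z. unfold gens. rewrite in_app_iff, in_map_iff, in_flat_map.
    split.
    - intros [[d [<- Hd]]|[d [Hd H]]].
      + left. now exists d.
      + right. apply in_flat_map in H. destruct H as [r [Hr Hz]]. apply in_seq in Hr.
        exists d, r. split; auto. split; [lia|]. destruct Hz as [<-|[<-|[]]]; auto.
    - intros [[d [Hd ->]]|[d [r [Hd [Hr Hz]]]]].
      + left. now exists d.
      + right. exists d. split; auto. apply in_flat_map. exists r.
        split; [apply in_seq; lia|]. destruct Hz as [->| ->]; [now left|now right; left]. }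
  destruct (farkas (S N) gens (pack 1 (fun _ => 0))) as [H|[w [Hw Hw0]]].
  - left.
    (* The row generators vanish against any u in the common kernel, so only the multipliers of the
       (d_0, b(d)) are collected into y. *)
    assert (Hcone : forall z, cone (S N) (fun d => In d gens) z ->
      exists y, cone (S m) (fun d => In d L) y /\ z O = y O /\
       forall u, (forall d, In d L -> vzero N (matvec N (hA d) u)) ->
         dot N (fun k => z (S k)) u = dot N (hb y) u).
    { intros z Hz. induction Hz as [z Hz|p l z' z Hp Hl Hz' [y [Hy [Hy0 Hyu]]] Hz].
      - exists (fun _ => 0). split; [|split].
        + apply cone_zero. now intros k _.
        + apply Hz. lia.
        + intros u _. rewrite hb_dot, !dot_zero_l; auto.
          * now intros k _.
          * intros k Hk. apply Hz. lia.
      - assert (Hzu : forall u, dot N (fun k => z (S k)) u =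
          l * dot N (fun k => p (S k)) u + 1 * dot N (fun k => z' (S k)) u).
        { intros u. rewrite <- dot_lin_l. apply dot_ext; [|now intros k _].
          intros k Hk. rewrite Hz by lia. ring. }
        pose proof (Hz O ltac:(lia)) as Hz0. cbv beta in Hz0.
        apply Hgens in Hp. destruct Hp as [[d [Hd ->]]|[d [r [Hd [Hr Hp]]]]].
        + exists (fun k => l * d k + 1 * y k). split; [|split].
          * apply cone_lin; auto; [lra|]. now apply cone_gen.
          * rewrite Hz0, Hy0. simpl. ring.
          * intros u Hu. rewrite Hzu, (Hyu u Hu), !hb_dot, dot_lin_l, <- !hb_dot.
            reflexivity.
        + exists y. split; [|split]; auto.
          * rewrite Hz0, Hy0. destruct Hp as [->| ->]; simpl; ring.
          * intros u Hu. rewrite Hzu, (Hyu u Hu).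
            assert (Hrow : dot N (hA d r) u = 0) by (apply (Hu d Hd r Hr)).
            destruct Hp as [->| ->]; simpl.
            -- change (fun k => hA d r k) with (hA d r). rewrite Hrow. ring.
            -- rewrite dot_lin_l, Hrow. ring. }
    destruct (Hcone _ H) as [y [Hy [Hy0 Hyu]]]. exists y. split; [|split]; auto.
    intros u Hu. rewrite <- (Hyu u Hu). apply dot_zero_l. now intros k _.
  - right. exists (fun k => w (S k)), (w O). rewrite dot_pack in Hw0.
    rewrite (dot_zero_l N (fun _ => 0)) in Hw0 by (now intros k _).
    split; [lra|]. intros d Hd. split.
    + intros r Hr.
      assert (H1 : dot (S N) (pack 0 (hA d r)) w <= 0).
      { apply Hw, Hgens. right. exists d, r. auto. }
      assert (H2 : dot (S N) (pack 0 (fun s => (-1) * hA d r s + 0 * hA d r s)) w <= 0).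
      { apply Hw, Hgens. right. exists d, r. auto. }
      rewrite dot_pack in H1, H2. rewrite dot_lin_l in H2.
      change (dot N (hA d r) (fun k => w (S k)) = 0). lra.
    + assert (H1 : dot (S N) (pack (d O) (hb d)) w <= 0).
      { apply Hw, Hgens. left. now exists d. }
      now rewrite dot_pack in H1.
Qed.

(** The alternative is applied to the active generators. Its first case yields an active gamma with
    b(gamma) orthogonal to V(F), which is excluded; in the second, a short step along v lowers the
    minimal value. *)
Lemma minimizer_face_definite x t :
  (exists g, Gamma N A mI mE g) ->
  dual_value_le x t -> (forall x' t', dual_value_le x' t' -> t <= t') ->
  (forall g, active_face x t g ->
     ~ (forall u, Vspace N A m (active_face x t) u -> dot N (bgam b m g) u = 0)) -> False.
Proof.
  intros Hne Hx Hmin Hproj.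
  pose (L := filter (fun d => if Req_EM_T (dot (S m) (gap x t) d) 0 then true else false) D).
  assert (HL : forall d, In d L <-> In d D /\ dot (S m) (gap x t) d = 0).
  { intros d. unfold L. rewrite filter_In.
    destruct (Req_EM_T (dot (S m) (gap x t) d) 0); intuition discriminate. }
  destruct (descent_alternative L) as [[y [Hy [Hy0 Hyu]]]|[v [tau [Htau Hv]]]].
  - assert (HF : active_face x t (dehom m y)).
    { apply active_face_dehom; auto.
      - revert Hy. apply cone_sub. intros d Hd. apply cone_gen. now apply HL.
      - apply (cone_dot_zero _ (fun d => In d L)); auto. intros d Hd. now apply HL. }
    apply (Hproj _ HF). intros u Hu.
    rewrite <- (Hyu u).
    + rewrite (dot_ext N _ (hb (hom (dehom m y))) u u).
      * rewrite !hb_dot. apply dot_ext; [now apply hom_dehom|now intros k _].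
      * intros k _. now rewrite hb_hom.
      * now intros k _.
    + intros d Hd. apply HL in Hd. destruct Hd as [Hd Hgap].
      apply (active_gen_kernel x t); auto. now exists (dehom m y).
  - destruct (list_uniform_step
      (fun d e => dot (S m) (gap (fun k => x k + e * v k) (t - e * tau)) d <= 0) D) as [e [He Hall]].
    + intros d Hd.
      pose proof (HD0 d Hd) as Hd0.
      assert (Hle : dot (S m) (gap x t) d <= 0) by exact (proj1 (dual_value_gens x t Hne) Hx d Hd).
      rewrite dot_gap in Hle.
      destruct (Req_dec (dot (S m) (gap x t) d) 0) as [Heq|Hneq].
      (* For an active d, A(d) v = 0 leaves 2 e b(d).v + e d_0 tau, which is at most - e d_0 tau <=
         0. *)
      * exists 1. split; [lra|]. intros e He. rewrite dot_gap, hL_line.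
        destruct (Hv d) as [Hker Hb]; [now apply HL|].
        unfold quad. rewrite !(dot_sym N _ (matvec N (hA d) v)), (dot_zero_l N _ x Hker), (dot_zero_l N _ v Hker).
        rewrite dot_gap in Heq.
        assert (0 <= e * (d O * tau)) by (apply Rmult_le_pos; nra).
        assert (e * (d O * tau + dot N (hb d) v) <= e * 0) by (apply Rmult_le_compat_l; lra).
        lra.
      (* An inactive d has strict slack, so a small enough step is harmless. *)
      * rewrite dot_gap in Hneq.
        destruct (small_step_neg (hL d x - d O * t)
          (2 * (dot N x (matvec N (hA d) v) + dot N (hb d) v) + d O * tau)
          (quad N (hA d) v)) as [e0 [He0 H]]; [lra|].
        exists e0. split; auto. intros e He. specialize (H e He).
        rewrite dot_gap, hL_line. lra.
    + apply (dual_value_gens _ _ Hne) in Hall. apply Hmin in Hall. nra.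
Qed.

End ConeGenerators.

(** Splits on whether the active face of the minimiser contains a definite multiplier. A vanishing
    projection is expressed as orthogonality of b(gamma) to V(F), so no projection has to be
    constructed. *)
Lemma exact_of_polyhedral g0 x0 t0 :
  polyhedron m (Gamma N A mI mE) ->
  Gamma N A mI mE g0 -> pd N (Agam A m g0) -> dual_value_le x0 t0 ->
  (forall F, face (Gamma N A mI mE) F -> (exists g, F g) ->
     (forall g, F g -> ~ pd N (Agam A m g)) ->
     forall g, F g -> ~ (forall u, Vspace N A m F u -> dot N (bgam b m g) u = 0)) ->
  exists x, qcqp_feasible N A b c mI mE x /\ qf N A b c 0 x <= t0.
Proof.
  intros HC Hg0 Hpd Hx0 Hproj.
  destruct (polyhedron_cone m _ HC) as [D [HD0 HD]].
  destruct (dual_value_minimizer g0 x0 t0 Hg0 Hpd Hx0) as [x [t [Hx [Ht Hmin]]]].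
  destruct (classic (exists g, active_face x t g /\ pd N (Agam A m g))) as [[g [[Hg Hgt] Hgpd]]|Hsd].
  - exists x. destruct (feasible_of_definite_multiplier g x t) as [Hf Hq]; auto.
    split; auto; lra.
  - exfalso. apply (minimizer_face_definite D HD0 HD x t); auto; [now exists g0|].
    intros g Hg. apply (Hproj (active_face x t)); auto.
    + now apply (active_face_face D HD).
    + now exists g.
    + intros g' Hg' Hp. apply Hsd. now exists g'.
Qed.

End Lagrangian.

(** * Weak duality and the theorem *)

(** Evaluate the form of Y at (- x.v, v). *)
Lemma schur_complement_psd n x X : symmetric n X -> psd (S n) (Ymat x X) ->
  psd n (fun r s => 1 * X r s + (-1) * outer x x r s).
Proof.
  intros HX [_ HY]. split.
  - intros r s Hr Hs. unfold outer. rewrite (HX r s) by easy. ring.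
  - intros v. specialize (HY (pack (- dot n x v) v)).
    rewrite quad_frob, frob_head in HY. simpl in HY. unfold outer at 1 2 3 in HY.
    unfold pack in HY at 1 2 3 4 5 6.
    rewrite (sumN_ext n (fun s => x s * (- dot n x v * v s)) (fun s => - dot n x v * (x s * v s))),
      (sumN_ext n (fun s => x s * (v s * - dot n x v)) (fun s => - dot n x v * (x s * v s))),
      sumN_scal in HY by (intros; ring).
    fold (dot n x v) in HY.
    rewrite quad_frob, frob_lin_l, frob_outer_outer.
    change (frob n (fun r s => X r s) (outer v v)) with (frob n X (outer v v)) in HY.
    change (frob n _ (fun r s => outer (pack (- dot n x v) v) (pack (- dot n x v) v) (S r) (S s)))
      with (frob n X (outer v v)) in HY. lra.
Qed.

Lemma rank_one_psd n x : psd (S n) (Ymat x (outer x x)).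
Proof.
  replace (Ymat x (outer x x)) with (outer (pack 1 x) (pack 1 x)).
  - split.
    + intros r s _ _. unfold outer. ring.
    + intros v. rewrite quad_frob, frob_outer_outer. apply Rle_0_sqr.
  - apply functional_extensionality; intros r. apply functional_extensionality; intros s.
    unfold outer, pack, Ymat. destruct r, s; ring.
Qed.

Lemma frob_Qmat n A b c i x X :
  frob (S n) (Qmat A b c i) (Ymat x X) = frob n (A i) X + 2 * dot n (b i) x + c i.
Proof.
  rewrite frob_head. simpl.
  change (frob n (fun r s => A i r s) (fun r s => X r s)) with (frob n (A i) X).
  unfold dot. ring.
Qed.

Lemma frob_Qmat_rank_one n A b c i x :
  frob (S n) (Qmat A b c i) (Ymat x (outer x x)) = qf n A b c i x.
Proof. now rewrite frob_Qmat, <- quad_frob. Qed.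

Lemma qcqp_sdp_feasible N A b c mI mE x :
  qcqp_feasible N A b c mI mE x -> sdp_feasible N A b c mI mE x (outer x x).
Proof.
  intros [HI HE]. split; [|split; [|split]].
  - intros r s _ _. unfold outer. ring.
  - apply rank_one_psd.
  - intros i Hi. rewrite frob_Qmat_rank_one. auto.
  - intros i Hi. rewrite frob_Qmat_rank_one. auto.
Qed.

(** Stated for general f so as to cover both f_i = q_i(x) and f_i = <Q_i, Y>. *)
Lemma dot_hom_le m mI f g : (forall i, (1 <= i <= mI)%nat -> 0 <= g i) ->
  (forall i, (1 <= i <= mI)%nat -> f i <= 0) ->
  (forall i, (mI + 1 <= i <= m)%nat -> f i = 0) ->
  dot (S m) (hom g) f <= f O.
Proof.
  intros Hg HI HE. rewrite dot_head.
  assert (0 <= sumN m (fun k => - (hom g (S k) * f (S k)))).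
  { apply sumN_nonneg. intros k Hk. simpl.
    destruct (Compare_dec.le_lt_dec (S k) mI) as [Hl|Hl].
    - specialize (Hg (S k) ltac:(lia)). specialize (HI (S k) ltac:(lia)). nra.
    - rewrite HE by lia. lra. }
  rewrite (sumN_ext m _ (fun k => -1 * (hom g (S k) * f (S k)))), sumN_scal in H by (intros; ring).
  unfold dot. simpl hom at 1. lra.
Qed.

Lemma frob_hA N mI mE A y Z :
  frob N (hA mI mE A y) Z = dot (S (mI + mE)) y (fun k => frob N (A k) Z).
Proof.
  unfold hA, dot. rewrite (frob_sumN_l N (S (mI + mE)) (fun k r s => y k * A k r s)).
  apply sumN_ext; intros k _.
  rewrite (frob_ext N _ (fun r s => y k * A k r s + 0 * A k r s) Z Z), frob_lin_l;
    [ring|intros; ring|auto].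
Qed.

(** Since <Q_i, Y> = q_i(x) + <A_i, X - x x^T>, the weighted sum exceeds L(gamma, x) by <A(gamma), X
    - x x^T>, a product of two semidefinite matrices. *)
Lemma weak_duality N mI mE A b c x X : sdp_feasible N A b c mI mE x X ->
  dual_value_le N mI mE A b c x (frob (S N) (Qmat A b c 0) (Ymat x X)).
Proof.
  intros [HX [HY [HI HE]]] g [_ [Hpsd Hpos]].
  pose (Z r s := 1 * X r s + (-1) * outer x x r s).
  assert (HZ : 0 <= frob N (hA mI mE A (hom g)) Z).
  { apply frob_psd_nonneg; [|now apply schur_complement_psd].
    revert Hpsd. apply psd_ext. intros; symmetry; apply hA_hom. }
  rewrite frob_hA in HZ.
  pose proof (dot_hom_le (mI + mE) mI
    (fun i => frob (S N) (Qmat A b c i) (Ymat x X)) g Hpos HI HE) as H.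
  rewrite (dot_ext _ (hom g) (hom g) _ (fun k => 1 * qf N A b c k x + 1 * frob N (A k) Z)) in H.
  - rewrite dot_lin_r in H. unfold hL. cbv beta in H. lra.
  - now intros k _.
  - intros k _. unfold Z. rewrite frob_Qmat, frob_lin_r. unfold qf. rewrite quad_frob. ring.
Qed.

(** * Perturbed objectives and passage to the limit *)

Lemma small_vector N (h : nat -> nat -> R) :
  (forall eps, 0 < eps -> exists J, forall j, (J <= j)%nat -> vnorm N (h j) < eps) ->
  forall eta, 0 < eta -> exists j, dot N (h j) (h j) < eta.
Proof.
  intros Hh eta He. destruct (Hh (sqrt eta)) as [J HJ]; [now apply sqrt_lt_R0|].
  exists J. apply sqrt_lt_0_alt. now apply HJ.
Qed.

(** Adds 2 w.x to the objective and w to every b(gamma), while the constraints and Gamma stay the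
    same. *)
Definition perturb (b : nat -> nat -> R) (w : nat -> R) : nat -> nat -> R :=
  fun i => match i with O => fun k => b O k + w k | S _ => b i end.

Theorem mainTheorem18
  (N mI mE : nat) (A : nat -> nat -> nat -> R) (b : nat -> nat -> R) (c : nat -> R)
  (HN : (1 <= N)%nat) (Hm : (1 <= mI + mE)%nat)
  (Hsym : forall i, (i <= mI + mE)%nat -> symmetric N (A i))
  (* Assumption A *)
  (HAfeas : exists x, qcqp_feasible N A b c mI mE x)
  (HAslater : exists g, (forall i, (1 <= i <= mI)%nat -> 0 <= g i) /\
                        pd N (Agam A (mI + mE) g))
  (* Assumption C *)
  (HC : polyhedron (mI + mE) (Gamma N A mI mE))
  (* the perturbation sequence *)
  (h : nat -> nat -> R)
  (Hh : forall eps, 0 < eps -> exists J, forall j, (J <= j)%nat -> vnorm N (h j) < eps)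
  (Hproj : forall F : (nat -> R) -> Prop,
      face (Gamma N A mI mE) F -> (exists g, F g) ->
      (forall g, F g -> ~ pd N (Agam A (mI + mE) g)) ->
      forall j g p, F g ->
        is_proj N (Vspace N A (mI + mE) F)
                (fun k => bgam b (mI + mE) g k + h j k) p ->
        ~ vzero N p) :
  same_inf
    (fun y => exists x, qcqp_feasible N A b c mI mE x /\ y = qf N A b c 0 x)
    (fun y => exists x X, sdp_feasible N A b c mI mE x X /\
                          y = frob (S N) (Qmat A b c 0) (Ymat x X)).
Proof.
  intros t. split; [|intros Ht y [x [Hx ->]]].
  2:{ apply Ht. exists x, (outer x x). split; [now apply qcqp_sdp_feasible|].
      now rewrite frob_Qmat_rank_one. }
  intros Ht y [x0 [X0 [Hx0 ->]]].
  destruct HAslater as [g [Hgpos Hgpd]]. set (m := (mI + mE)%nat) in *.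
  (* Coordinates outside 1..m are reset to 0 so that the definite multiplier lies in Gamma; A(gamma)
     does not change. *)
  pose (g0 := dehom m (hom g)).
  assert (Hpd : pd N (Agam A m g0)).
  { revert Hgpd. apply pd_ext. intros r s. unfold m. rewrite <- !hA_hom. unfold hA.
    symmetry. apply dot_ext; [now apply hom_dehom|now intros k _]. }
  assert (Hg0 : Gamma N A mI mE g0).
  { split; [apply dehom_in_Rm|]. split; [now apply pd_psd|].
    intros i Hi. unfold g0, dehom. destruct i; [lia|].
    destruct (Nat.leb (S i) m); [now apply Hgpos|lra]. }
  assert (Hexact : forall j, exists x, qcqp_feasible N A b c mI mE x /\
     qf N A b c 0 x + 2 * dot N (h j) x
     <= frob (S N) (Qmat A b c 0) (Ymat x0 X0) + 2 * dot N (h j) x0).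
  { intros j.
    assert (Hsdp : sdp_feasible N A (perturb b (h j)) c mI mE x0 X0).
    { destruct Hx0 as [HX [HY [HI HE]]]. split; [|split; [|split]]; auto.
      - intros [|i] Hi; [lia|]. exact (HI _ Hi).
      - intros [|i] Hi; [lia|]. exact (HE _ Hi). }
    destruct (exact_of_polyhedral N mI mE A (perturb b (h j)) c Hsym g0 x0 _ HC Hg0 Hpd
      (weak_duality _ _ _ _ _ _ _ _ Hsdp)) as [x [[HI HE] Hle]].
    - intros F HF HFne HFsd g' Hg' Hz.
      apply (Hproj F HF HFne HFsd j g' (fun _ => 0) Hg'); [|now intros k _].
      split.
      + intros g1 Hg1 k _. apply sumN_zero. intros; ring.
      + intros u Hu. eapply eq_trans; [|exact (Hz u Hu)]. apply dot_ext; [|now intros k _].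
        intros k _. unfold bgam, perturb. cbv beta iota. fold m. ring.
    - exists x. split.
      + split; intros [|i] Hi; try lia; [exact (HI _ Hi)|exact (HE _ Hi)].
      + rewrite frob_Qmat in *. unfold qf in *. simpl in Hle. rewrite !dot_plus_l in Hle. lra. }
  set (M := frob (S N) (Qmat A b c 0) (Ymat x0 X0)) in *.
  destruct (hL_coercive N mI mE A b c (hom g0)) as [mu [C [Hmu HCo]]].
  { revert Hpd. apply pd_ext. intros r s. symmetry. apply hA_hom. }
  set (D0 := dot N x0 x0).
  (* The bound on mu/2 |x|^2 obtained from coercivity and the Young estimate with s = mu / 2, when
     |h_j|^2 < 1; it does not depend on j. *)
  pose (K := M + C + 4 / mu + mu / 2 * D0).
  pose (B := Rabs (2 / mu * K)).
  assert (HD0 : 0 <= D0) by apply dot_self_nonneg.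
  assert (HB : 0 <= B) by apply Rabs_pos.
  apply Rnot_lt_le. intros Hlt.
  (* Makes delta (D0 + B + 1) half of the gap t - M; h_j is then chosen so small that the other
     Young term stays below the other half. *)
  pose (delta := (t - M) / (2 * (D0 + B + 1))).
  assert (Hdelta : 0 < delta) by (apply Rdiv_lt_0_compat; lra).
  destruct (small_vector N h Hh (Rmin 1 (delta * (t - M) / 4))) as [j Hj].
  { apply Rmin_pos; [lra|]. apply Rdiv_lt_0_compat; nra. }
  pose proof (Rlt_le_trans _ _ _ Hj (Rmin_l _ _)) as Hj1.
  pose proof (Rlt_le_trans _ _ _ Hj (Rmin_r _ _)) as Hj2.
  set (H2 := dot N (h j) (h j)) in *.
  destruct (Hexact j) as [x [Hx Hle]].
  assert (Htx : t <= qf N A b c 0 x) by (apply Ht; now exists x).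
  assert (HLx : hL N mI mE A b c (hom g0) x <= qf N A b c 0 x).
  { apply (dot_hom_le (mI + mE) mI (fun i => qf N A b c i x)); [apply Hg0|apply Hx|apply Hx]. }
  specialize (HCo x).
  (* Exactness of the j-th problem gives q_0(x) <= M + 2 h_j.(x0 - x); each of the two products is
     estimated by Young with weight 1/s. *)
  assert (Hy : forall s, 0 < s ->
    qf N A b c 0 x <= M + 2 * (/ s * H2) + s * (D0 + dot N x x)).
  { intros s Hs. assert (Hi : 0 < / s) by now apply Rinv_0_lt_compat.
    pose proof (dot_young N (/ s) (h j) x0 Hi) as Y1.
    pose proof (dot_young N (/ s) (h j) (fun k => (-1) * x k + 0 * x k) Hi) as Y2.
    rewrite !dot_lin_r, !dot_lin_l in Y2. rewrite Rinv_inv in Y1, Y2.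
    fold H2 D0 in Y1, Y2. lra. }
  assert (HxB : dot N x x <= B).
  { eapply Rle_trans; [|apply Rle_abs].
    pose proof (Hy (mu / 2) ltac:(lra)) as H.
    replace (/ (mu / 2)) with (2 / mu) in H by (field; lra).
    assert (2 / mu * H2 <= 2 / mu * 1).
    { apply Rmult_le_compat_l; [|lra]. apply Rlt_le, Rdiv_lt_0_compat; lra. }
    apply Rmult_le_reg_l with (mu / 2); [lra|].
    replace (mu / 2 * (2 / mu * K)) with K by (field; lra). unfold K.
    replace (4 / mu) with (2 * (2 / mu * 1)) by (field; lra). lra. }
  pose proof (Hy delta Hdelta) as H.
  assert (/ delta * H2 < (t - M) / 4).
  { apply Rmult_lt_reg_l with delta; auto. rewrite <- Rmult_assoc, Rinv_r by lra. lra. }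
  assert (delta * (D0 + dot N x x) <= delta * (D0 + B + 1)) by (apply Rmult_le_compat_l; lra).
  assert (delta * (D0 + B + 1) = (t - M) / 2) by (unfold delta; field; lra).
  lra.
Qed.
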